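(* Let $\mathcal H$ be a separable Hilbert space, let $A$ and $K$ be bounded self-adjoint operators on $\mathcal H$, and let $K$ be in the trace class. Let $\sigma$ be an arbitrary singular measure on $\mathbb R$. Let $K=K_+-K_-$ be the spectral decomposition of $K$ into its positive and negative parts, $K_\pm=\pm K\,\mathbf E_K(\mathbb R_\pm)$, where $\mathbf E_K$ is the projection-valued spectral measure of $K$ and $\mathbb R_+=(0,\infty)$, $\mathbb R_-=(-\infty,0)$. If $\operatorname{Ran} K$ is cyclic for $A$, then the spectral measure of the operator $$A_{\vec t}=A+t_1K_++t_2K_-,\qquad \vec t=(t_1,t_2)\in\mathbb R^2,$$ is mutually singular with $\sigma$ for all $\vec t\in\mathbb R^2\setminus E$, where the exceptional set $E$ has Hausdorff dimension at most $1$.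
   Context: Measures on $\mathbb R$ are finite non-negative Borel measures; ''singular'' means singular with respect to Lebesgue measure. Operators are bounded. For a self-adjoint operator $A$ on $\mathcal H$ with projection-valued spectral measure $\mathbf E$, the scalar spectral measure of $\mathbf x\in\mathcal H$ is $\mu_{\mathbf x}(\cdot)=\langle \mathbf E(\cdot)\mathbf x,\mathbf x\rangle$. A vector $\mathbf x$ has maximal spectral type if $\mu_{\mathbf y}\ll\mu_{\mathbf x}$ for every $\mathbf y\in\mathcal H$. ''The spectral measure of $A$'' means a scalar spectral measure of maximal spectral type, i.e. $\mu_{\mathbf x}$ for some $\mathbf x$ of maximal spectral type; it is unique up to mutual absolute continuity. A set $S\subset\mathcal H$ is cyclic for $A$ if the smallest closed $A$-invariant subspace containing $S$ is $\mathcal H$. *)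

(* Defs.v *)
From HB Require Import structures.
From mathcomp Require Import all_boot all_order all_algebra.
From mathcomp Require Import complex.
From mathcomp Require Import all_classical all_reals all_analysis.

Set Implicit Arguments.
Unset Strict Implicit.
Unset Printing Implicit Defensive.

Import Order.TTheory GRing.Theory Num.Theory.
Import numFieldNormedType.Exports.

Local Open Scope classical_set_scope.
Local Open Scope complex_scope.
Local Open Scope ring_scope.

(** * Complex Hilbert spaces *)

(** The inner product is linear in its first argument. *)
HB.mixin Record CompleteNormedModule_isHilbert (R : realType) H
    of CompleteNormedModule R[i] H := {
  dotp : H -> H -> R[i];
  dotp_linear : forall a u v w, dotp (a *: u + v) w = a * dotp u w + dotp v w;
  dotp_conj : forall u v, dotp v u = (dotp u v)^*;
  dotp_norm : forall u, dotp u u = `|u| ^+ 2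
}.

#[short(type="hilbertType")]
HB.structure Definition Hilbert (R : realType) :=
  {H of CompleteNormedModule R[i] H & CompleteNormedModule_isHilbert R H}.

Section dotp_theory.
Context {R : realType} {H : hilbertType R}.
Implicit Types u v w x : H.

Lemma dotpDl u v w : dotp (u + v) w = dotp u w + dotp v w.
Proof. by rewrite -[u in LHS]scale1r dotp_linear mul1r. Qed.

Lemma dot0p w : dotp 0 w = 0.
Proof. by apply: (addrI (dotp 0 w)); rewrite -dotpDl !addr0. Qed.

Lemma dotpZl a u w : dotp (a *: u) w = a * dotp u w.
Proof. by rewrite -[a *: u]addr0 dotp_linear dot0p addr0. Qed.

Lemma dotpNl u w : dotp (- u) w = - dotp u w.
Proof. by rewrite -scaleN1r dotpZl mulN1r. Qed.

Lemma dotpBl u v w : dotp (u - v) w = dotp u w - dotp v w.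
Proof. by rewrite dotpDl dotpNl. Qed.

Lemma dotp_suml I (r : seq I) (F : I -> H) w :
  dotp (\sum_(i <- r) F i) w = \sum_(i <- r) dotp (F i) w.
Proof.
by elim/big_rec2: _ => [|i a u _ <-]; rewrite ?dot0p// dotpDl.
Qed.

Lemma dotpZr a u w : dotp u (a *: w) = a^* * dotp u w.
Proof. by rewrite dotp_conj dotpZl rmorphM /= -dotp_conj. Qed.

Lemma dotpBr u v w : dotp u (v - w) = dotp u v - dotp u w.
Proof. by rewrite dotp_conj dotpBl rmorphB /= -!dotp_conj. Qed.

Lemma CauchySchwarz u v : `|dotp u v| <= `|u| * `|v|.
Proof.
have [->|v0] := eqVneq v 0.
  by rewrite dotp_conj dot0p rmorph0 !normr0 mulr0.
have nv0 : `|v| ^+ 2 != 0 by rewrite expf_neq0// normr_eq0.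
pose c := dotp u v / `|v| ^+ 2.
have : 0 <= dotp (u - c *: v) (u - c *: v) by rewrite dotp_norm exprn_ge0.
rewrite dotpBl !dotpBr !dotpZl !dotpZr !dotp_norm (dotp_conj u v).
have cE : c^* = (dotp u v)^* / `|v| ^+ 2.
  by rewrite rmorphM fmorphV rmorphXn /= (geC0_conj (normr_ge0 v)).
have -> : c^* * `|v| ^+ 2 = (dotp u v)^* by rewrite cE mulfVK.
rewrite subrr subr0 subr_ge0.
have -> : c^* * dotp u v = `|dotp u v| ^+ 2 / `|v| ^+ 2.
  by rewrite cE mulrAC -normCKC.
rewrite ler_pdivrMr ?exprn_gt0 ?normr_gt0// -exprMn.
by rewrite ler_pXn2r// nnegrE ?mulr_ge0.
Qed.

End dotp_theory.

(** * Operators on a Hilbert space *)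

Section operators.
Context {R : realType} {H : hilbertType R}.
Implicit Types (T S : H -> H) (V X : set H).

Definition separable_space := exists2 D : set H, countable D & dense D.

Definition bounded_operator T :=
  exists M : R, forall u, `|T u| <= M%:C * `|u|.

Definition is_adjoint T S := forall u v, dotp (T u) v = dotp u (S v).

Definition self_adjoint T := is_adjoint T T.

Definition positive_operator T := self_adjoint T /\ forall u, 0 <= dotp (T u) u.

Definition closed_subspace V :=
  [/\ closed V, V 0 & forall (a : R[i]) u v, V u -> V v -> V (a *: u + v)].

Definition invariant_subspace T V := forall u, V u -> V (T u).

Definition cyclic_set T X :=
  smallest [set V | closed_subspace V /\ invariant_subspace T V] X = [set: H].

Definition orthonormal_basis X :=
  [/\ forall u, X u -> dotp u u = 1,
      forall u v, X u -> X v -> u != v -> dotp u v = 0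
    & smallest closed_subspace X = [set: H]].

(** [P] is the positive square root [|T|] of [T' T], where [T'] is the adjoint
    of [T]; the trace of [|T|] does not depend on the orthonormal basis. *)
Definition trace_class T :=
  exists (T' : H -> H) (P : {linear H -> H}) (X : set H),
    [/\ is_adjoint T T',
        bounded_operator P /\ positive_operator P,
        forall u, P (P u) = T' (T u),
        orthonormal_basis X
      & (\esum_(e in X) (complex.Re (dotp (P e) e))%:E < +oo)%E].

End operators.

Arguments separable_space {R} H.

(** * Projection-valued measures and spectral measures *)

(** Only the values of [pvm_proj] at Borel sets are constrained. *)
Record pvm (R : realType) (H : hilbertType R) := PVM {
  pvm_proj :> set (measurableTypeR R) -> {linear H -> H};
  pvm_self_adjoint : forall B, measurable B -> self_adjoint (pvm_proj B);
  pvm_set0 : forall u, pvm_proj set0 u = 0;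
  pvm_setT : forall u, pvm_proj setT u = u;
  pvm_setI : forall B C, measurable B -> measurable C ->
    forall u, pvm_proj (B `&` C) u = pvm_proj B (pvm_proj C u);
  pvm_sigma_additive : forall F : (set (measurableTypeR R))^nat,
    (forall i, measurable (F i)) -> trivIset setT F ->
    forall u, \sum_(0 <= i < n) pvm_proj (F i) u @[n --> \oo] -->
              pvm_proj (\bigcup_i F i) u
}.

Section scalar_measure.
Context {R : realType} {H : hilbertType R} (E : pvm H) (u : H).

(** The value [0] off the Borel sets is a convention: measures of the library
    are total functions on sets. *)
Definition scalar_measure (B : set (measurableTypeR R)) : \bar R :=
  if `[< measurable B >] then (complex.Re (dotp (E B u) u))%:E else 0%E.

Lemma scalar_measureE B : measurable B ->
  scalar_measure B = (complex.Re (dotp (E B u) u))%:E.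
Proof. by move=> mB; rewrite /scalar_measure asboolT. Qed.

Let scalar_measure0 : scalar_measure set0 = 0%E.
Proof. by rewrite scalar_measureE// pvm_set0 dot0p. Qed.

Let scalar_measure_ge0 B : (0 <= scalar_measure B)%E.
Proof.
rewrite /scalar_measure; case: asboolP => // mB.
rewrite lee_fin -[in E B u](setIid B) pvm_setI// pvm_self_adjoint// dotp_norm.
have : 0 <= `|E B u| ^+ 2 by rewrite exprn_ge0.
by case: (_ ^+ 2) => a b; rewrite lecE => /andP[].
Qed.

Let scalar_measure_sigma_additive : semi_sigma_additive scalar_measure.
Proof.
move=> F mF tF mUF; rewrite scalar_measureE//.
have -> : (fun n => \sum_(0 <= i < n) scalar_measure (F i))%E =
    EFin \o (fun n => complex.Re (dotp (\sum_(0 <= i < n) E (F i) u) u)).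
  apply/funext => n /=; rewrite dotp_suml raddf_sum -sumEFin.
  by apply: eq_bigr => i _; rewrite scalar_measureE.
apply: cvg_EFin; first exact: nearW.
apply/cvgrPdist_le => e e0.
have u1 : 0 < `|u| + 1 by rewrite ltr_wpDl.
have e1 : 0 < e%:C / (`|u| + 1) by rewrite divr_gt0// ltcR.
have /cvgrPdist_le /(_ _ e1) := @pvm_sigma_additive _ _ E F mF tF u.
apply: filterS => n En /=.
rewrite -raddfB -dotpBl -lecR (le_trans (normc_ge_Re _))//.
rewrite (le_trans (CauchySchwarz _ _))//.
rewrite (le_trans (ler_wpM2r _ En))// mulrAC ler_pdivrMr//.
by rewrite ler_wpM2l ?ler_wpDr// ltW// ltcR.
Qed.

HB.instance Definition _ := isMeasure.Build _ _ _ scalar_measure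
  scalar_measure0 scalar_measure_ge0 scalar_measure_sigma_additive.

Let scalar_measure_fin : fin_num_fun scalar_measure.
Proof. by move=> B mB; rewrite scalar_measureE. Qed.

HB.instance Definition _ := Measure_isFinite.Build _ _ _ scalar_measure
  scalar_measure_fin.

End scalar_measure.

Section spectral_measures.
Context {R : realType} {H : hilbertType R}.
Implicit Types (T : H -> H) (E : pvm H) (mu nu : set (measurableTypeR R) -> \bar R).

(** [T] is the integral of [l] against [E(dl)], as an equality of quadratic
    forms; by polarization the quadratic form determines [T]. *)
Definition spectral_pvm T E := forall u,
  (scalar_measure E u).-integrable setT (fun l => l%:E) /\
  dotp (T u) u = (\int[scalar_measure E u]_l l)%:C.

Definition maximal_spectral_type E u :=
  forall v, scalar_measure E v `<< scalar_measure E u.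

Definition spectral_measure T mu := exists E u,
  [/\ spectral_pvm T E, maximal_spectral_type E u & mu = scalar_measure E u].

Definition positive_part T E : H -> H := fun u => T (E `]0, +oo[%classic u).

Definition negative_part T E : H -> H := fun u => - T (E `]-oo, 0[%classic u).

Definition mutually_singular mu nu :=
  exists B, [/\ measurable B, mu B = 0%E & nu (~` B) = 0%E].

End spectral_measures.

(** * Hausdorff dimension *)

Section hausdorff.
Context {R : realType} {T : Type} (d : T -> T -> R).
Implicit Types (U S : set T) (s delta : R).
Local Open Scope ereal_scope.

Definition diameter U : \bar R :=
  ereal_sup [set (d p.1 p.2)%:E | p in U `*` U].

(** The case distinction only matters for [s = 0]. *)
Definition diameter_power s U : \bar R :=
  if `[< U = set0 >] then 0 else diameter U `^ s.

Definition hausdorff_premeasure s delta S : \bar R :=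
  ereal_inf [set \sum_(0 <= i <oo) diameter_power s (U i) | U in
    [set U : (set T)^nat | S `<=` \bigcup_i U i /\
                           forall i, diameter (U i) <= delta%:E]].

Definition hausdorff_measure s S : \bar R :=
  ereal_sup [set hausdorff_premeasure s delta S |
             delta in [set delta : R | (0 < delta)%R]].

Definition hausdorff_dim S : \bar R :=
  ereal_inf [set s%:E | s in
    [set s : R | (0 <= s)%R /\ hausdorff_measure s S = 0]].

End hausdorff.

Definition euclidean_dist {R : realType} (p q : R * R) : R :=
  Num.sqrt ((p.1 - q.1) ^+ 2 + (p.2 - q.2) ^+ 2).

(* Main.v *)
Require Import Defs.
From HB Require Import structures.
From mathcomp Require Import all_boot all_order all_algebra.
From mathcomp Require Import complex.
From mathcomp Require Import all_classical all_reals all_analysis.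
From mathcomp Require Import measurable_realfun.
From mathcomp Require Import ring lra.

Set Implicit Arguments.
Unset Strict Implicit.
Unset Printing Implicit Defensive.

Import Order.TTheory GRing.Theory Num.Theory.
Import numFieldNormedType.Exports.

Local Open Scope classical_set_scope.
Local Open Scope complex_scope.
Local Open Scope ring_scope.

(** Let [t] be exceptional. A Hahn decomposition yields [v <> 0] whose spectral
    measure for [A_t] is at most [sigma] and is carried by one of countably
    many null sets [C], each covered by few short dyadic cells. Cut [v] into
    [w_j = E_t(cell_j) v] and put [Q_+(t, t') = \sum_j <K_+ w_j, w'_j> /
    sigma(cell_j)], and [Q_-] likewise for [K_-]. The diagonal terms [Q_+(t,
    t)] and [Q_-(t, t)] increase under refinement of the cells, are bounded by
    the trace of [|K|], and do not both vanish since [Ran K] is cyclic. On the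
    other hand [<(A_t - A_t') w_j, w'_j>] is at most twice the length of the
    cell times [sigma(cell_j)], hence [(t_1 - t'_1) Q_+(t, t') + (t_2 - t'_2)
    Q_-(t, t') -> 0]. Grouping the exceptional parameters into countably many
    classes on which the profiles [w] are close makes [Q_+(t, t')] and [Q_-(t,
    t')] close to the diagonal terms, so in each class one of [t_1 - t'_1],
    [t_2 - t'_2] is at most twice the other: every class is a Lipschitz graph
    over a subset of the line. *)

(** * Real inner product and quadratic forms *)

(** The sums [Q] replace an integral of [<K_+ f, f'>] against [sigma], where [f] would be the
    density of [E_t(.) v] with respect to [sigma]; such a density need not take values in [H], so
    only its averages over cells are used. Trace class keeps the integral finite: the vectors
    [w_j / sqrt(sigma(cell_j))] are orthogonal of norm at most 1, so the bound does not depend on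
    the number of cells. Singularity of [sigma] enters through the lengths: only cells meeting [C]
    contribute to the commutator.

    The obstacle is that the commutator is small only at late levels, while a countable
    classification can inspect only finitely many vectors, hence one fixed level [n0]. Monotonicity
    bridges the gap: once the forms of [v] and [v'] have nearly reached their suprema at [n0],
    closeness at [n0] persists at all finer levels. At level [n0] the finitely many [w_j] are
    rounded to a countable dense set; here separability is used. Which of the two differences is
    controlled depends on which form has the larger supremum: the larger one stays away from 0 and
    bounds the other. *)

Section real_inner_product.
Context {R : realType} {H : hilbertType R}.
Implicit Types (x y z u v w : H) (a b c : R) (T S : H -> H).

(** All estimates below concern real-valued quadratic forms, so [H] is treated as a real inner
    product space; complex scalars return only where orthonormal bases and cyclicity require
    them. *)
Definition rdot x y : R := complex.Re (dotp x y).

Lemma rdotC x y : rdot x y = rdot y x.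
Proof. by rewrite /rdot (dotp_conj x y); case: (dotp x y). Qed.

Lemma rdotDl x y z : rdot (x + y) z = rdot x z + rdot y z.
Proof. by rewrite /rdot dotpDl raddfD. Qed.

Lemma rdotZl a x z : rdot (a%:C *: x) z = a * rdot x z.
Proof.
by rewrite /rdot dotpZl; case: (dotp x z) => p q /=; rewrite mul0r subr0.
Qed.

Lemma rdot_norm x : dotp x x = (rdot x x)%:C.
Proof.
rewrite /rdot; have : 0 <= dotp x x by rewrite dotp_norm exprn_ge0.
by case: (dotp x x) => p q /=; rewrite lecE/= => /andP[/eqP -> _].
Qed.

Lemma rdot_ge0 x : 0 <= rdot x x.
Proof. by rewrite -lecR -rdot_norm dotp_norm exprn_ge0. Qed.

Lemma normE x : `|x| = (Num.sqrt (rdot x x))%:C.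
Proof.
apply/eqP; rewrite -(@eqrXn2 _ 2%N)//; last by rewrite lecR sqrtr_ge0.
by rewrite -dotp_norm -rmorphXn/= sqr_sqrtr ?rdot_ge0// rdot_norm.
Qed.

Lemma rdot_eq0 x : rdot x x = 0 -> x = 0.
Proof.
by move=> x0; apply/eqP; rewrite -normr_eq0 normE x0 sqrtr0.
Qed.

Definition symmetric_form (b : H -> H -> R) :=
  [/\ forall x y, b x y = b y x,
      forall x y z, b (x + y) z = b x z + b y z
    & forall a x z, b (a%:C *: x) z = a * b x z].

Definition psd_form (b : H -> H -> R) :=
  symmetric_form b /\ forall x, 0 <= b x x.

Lemma rdot_symmetric : symmetric_form rdot.
Proof. by split; [exact: rdotC|exact: rdotDl|exact: rdotZl]. Qed.

Lemma rdot_psd : psd_form rdot.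
Proof. by split; [exact: rdot_symmetric|exact: rdot_ge0]. Qed.

Section forms.
Variable k : H -> H -> R.
Hypothesis ks : symmetric_form k.

Let kC : forall x y, k x y = k y x. Proof. by case: ks. Qed.

Lemma formDl x y z : k (x + y) z = k x z + k y z. Proof. by case: ks. Qed.

Lemma formDr x y z : k z (x + y) = k z x + k z y.
Proof. by rewrite !(kC z) formDl. Qed.

Lemma formZl a x z : k (a%:C *: x) z = a * k x z. Proof. by case: ks. Qed.

Lemma formZr a x z : k z (a%:C *: x) = a * k z x.
Proof. by rewrite !(kC z) formZl. Qed.

Lemma form0l z : k 0 z = 0.
Proof. by rewrite -(scale0r (0 : H)) -[0 in LHS]/(0%:C) formZl mul0r. Qed.

Lemma form0r z : k z 0 = 0. Proof. by rewrite kC form0l. Qed.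

Lemma formNl x z : k (- x) z = - k x z.
Proof. by apply: (addrI (k x z)); rewrite -formDl !subrr form0l. Qed.

Lemma formNr x z : k z (- x) = - k z x.
Proof. by rewrite !(kC z) formNl. Qed.

Lemma formBl x y z : k (x - y) z = k x z - k y z.
Proof. by rewrite formDl formNl. Qed.

Lemma formBr x y z : k z (x - y) = k z x - k z y.
Proof. by rewrite formDr formNr. Qed.

Lemma form_suml I (r : seq I) (F : I -> H) z :
  k (\sum_(i <- r) F i) z = \sum_(i <- r) k (F i) z.
Proof.
by elim/big_rec2: _ => [|i p u _ <-]; rewrite ?form0l// formDl.
Qed.

Lemma form_sumr I (r : seq I) (F : I -> H) z :
  k z (\sum_(i <- r) F i) = \sum_(i <- r) k z (F i).
Proof. by rewrite kC form_suml; apply: eq_bigr => i _. Qed.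

Lemma form_sqrD x y : k (x + y) (x + y) = k x x + 2 * k x y + k y y.
Proof. by rewrite formDl !formDr (kC y x); ring. Qed.

Lemma form_sqrB x y : k (x - y) (x - y) = k x x - 2 * k x y + k y y.
Proof. by rewrite formBl !formBr (kC y x); ring. Qed.

End forms.

Section psd_forms.
Variable k : H -> H -> R.
Hypothesis kp : psd_form k.

Let ks : symmetric_form k := kp.1.

Lemma psd_ge0 x : 0 <= k x x. Proof. exact: kp.2. Qed.

Lemma psd_CauchySchwarz x y : k x y ^+ 2 <= k x x * k y y.
Proof.
have h a : 0 <= k y y * a ^+ 2 - 2 * k x y * a + k x x.
  have := psd_ge0 (x - a%:C *: y).
  by rewrite form_sqrB// !(formZr ks) !(formZl ks); lra.
have := psd_ge0 x; have := psd_ge0 y; rewrite le_eqVlt => /orP[/eqP y0|y0] x0.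
  rewrite -y0 mulr0; have [->|xy] := eqVneq (k x y) 0; first by rewrite expr0n.
  (* With [k y y = 0] the polynomial in [a] is affine; this [a] gives it the value -1. *)
  have := h ((k x x + 1) / (2 * k x y)).
  have -> : 2 * k x y * ((k x x + 1) / (2 * k x y)) = k x x + 1.
    by rewrite mulrC mulfVK// mulf_neq0.
  by rewrite -y0 mul0r; lra.
have := h (k x y / k y y); rewrite -(ler_pM2r y0) mul0r.
have yn : k y y != 0 by rewrite gt_eqF.
have -> : (k y y * (k x y / k y y) ^+ 2 - 2 * k x y * (k x y / k y y) + k x x)
    * k y y = k x x * k y y - k x y ^+ 2 by field.
by rewrite subr_ge0.
Qed.

Lemma psd_eq0l x y : k x x = 0 -> k x y = 0.
Proof.
move=> x0; have := psd_CauchySchwarz x y; rewrite x0 mul0r => h.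
by apply/eqP; rewrite -sqrf_eq0 eq_le h sqr_ge0.
Qed.

Lemma psd_sqrD_le x y : k (x + y) (x + y) <= 2 * k x x + 2 * k y y.
Proof.
by have := psd_ge0 (x - y); rewrite form_sqrB// form_sqrD//; lra.
Qed.

Lemma psd_sqrB_le x y : k (x - y) (x - y) <= 2 * k x x + 2 * k y y.
Proof.
by have := psd_ge0 (x + y); rewrite form_sqrB// form_sqrD//; lra.
Qed.

End psd_forms.

Lemma rdot_inj x y : (forall z, rdot x z = rdot y z) -> x = y.
Proof.
move=> h; apply/eqP; rewrite -subr_eq0; apply/eqP/rdot_eq0.
by rewrite (formBl rdot_symmetric) h subrr.
Qed.

Section self_adjoint_operators.
Variable T : H -> H.
Hypothesis Tsa : self_adjoint T.

Lemma self_adjoint_rdot x y : rdot (T x) y = rdot x (T y).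
Proof. by rewrite /rdot Tsa. Qed.

(** Symmetry forces additivity: pair with a test vector and move [T] across. This supplies linearity
    for operators given as plain functions, such as the two parts of [K] and [A_t]. *)
Lemma self_adjointD x y : T (x + y) = T x + T y.
Proof.
by apply: rdot_inj => z; rewrite rdotDl !self_adjoint_rdot rdotDl.
Qed.

Lemma self_adjoint0 : T 0 = 0.
Proof. by apply: (addrI (T 0)); rewrite -self_adjointD !addr0. Qed.

Lemma self_adjointZ a x : T (a%:C *: x) = a%:C *: T x.
Proof.
by apply: rdot_inj => z; rewrite rdotZl !self_adjoint_rdot rdotZl.
Qed.

Lemma self_adjoint_form : symmetric_form (fun x y => rdot (T x) y).
Proof.
split=> [x y|x y z|a x z]; first by rewrite self_adjoint_rdot rdotC.
  by rewrite self_adjointD rdotDl.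
by rewrite self_adjointZ rdotZl.
Qed.

End self_adjoint_operators.

(** [C] bounds the square of the operator norm, which keeps square roots out of the estimates. *)
Definition rbounded T C := 0 <= C /\ forall x, rdot (T x) (T x) <= C * rdot x x.

Lemma bounded_operatorP T : bounded_operator T -> exists C, rbounded T C.
Proof.
move=> [M hM]; exists (M ^+ 2); split=> [|x]; first exact: sqr_ge0.
have := hM x; rewrite !normE -rmorphM/= lecR => h.
have h0 : 0 <= Num.sqrt (rdot (T x) (T x)) by exact: sqrtr_ge0.
rewrite -(sqr_sqrtr (rdot_ge0 (T x))) -[in leRHS](sqr_sqrtr (rdot_ge0 x)).
rewrite -exprMn ler_pXn2r// nnegrE //; exact: le_trans h.
Qed.

Lemma rbounded_form T C x : rbounded T C ->
  rdot (T x) x <= (C + 1) * rdot x x.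
Proof.
move=> [C0 TC]; have := psd_sqrB_le rdot_psd (T x) x.
have := psd_ge0 rdot_psd (T x - x); rewrite (form_sqrB rdot_symmetric).
have := TC x; have := rdot_ge0 x; nra.
Qed.

End real_inner_product.

(** * Monotonicity of the operator square root *)

Section form_sqrt_monotone.
Context {R : realType} {H : hilbertType R}.
Variables (P Q : H -> H) (CP CQ : R).
Hypotheses (Psa : self_adjoint P) (Qsa : self_adjoint Q).
Hypotheses (P0 : forall x, 0 <= rdot (P x) x) (Q0 : forall x, 0 <= rdot (Q x) x).
Hypotheses (PC : rbounded P CP) (QC : rbounded Q CQ).
Hypothesis QP : forall x, rdot (Q x) (Q x) <= rdot (P x) (P x).

Let d x y : R := rdot (P x) y - rdot (Q x) y.

Let lower := [set l : R | forall x, l * rdot x x <= d x x].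

Let d_ge x : - (CQ + 1) * rdot x x <= d x x.
Proof. by rewrite /d; have := rbounded_form x QC; have := P0 x; lra. Qed.

(* If the form [P - Q] had a negative infimum [l], a near minimizer [x] would
   be a near eigenvector, [(P - Q) x ~ l x], and then
   [0 <= |P x|^2 - |Q x|^2 = <(P - Q) x, (P + Q) x> ~ l <(P + Q) x, x> < 0]. *)
Lemma sqrt_form_monotone x : rdot (Q x) x <= rdot (P x) x.
Proof.
apply/contraT; rewrite -ltNge => x_neg; exfalso.
have dx0 : d x x < 0 by rewrite /d; lra.
have nx0 : 0 < rdot x x.
  rewrite lt_def rdot_ge0 andbT; apply/eqP => /rdot_eq0 x0.
  by move: x_neg; rewrite x0 !(rdotC _ 0) !(form0l rdot_symmetric) ltxx.
have ubl : ubound lower (d x x / rdot x x).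
  by move=> l hl; rewrite ler_pdivlMr.
have hs : has_sup lower.
  by split; [exists (- (CQ + 1)) => y; exact: d_ge|exists (d x x / rdot x x)].
pose l := sup lower.
have l0 : l < 0.
  apply: (@le_lt_trans _ _ (d x x / rdot x x)).
    by apply: ge_sup => //; exact: hs.1.
  by rewrite pmulr_llt0 ?invr_gt0.
have ln y : l * rdot y y <= d y y.
  have [/rdot_eq0 ->|yn] := eqVneq (rdot y y) 0.
    by rewrite /d !(rdotC _ 0) !(form0l rdot_symmetric) mulr0 subrr.
  have y0 : 0 < rdot y y by rewrite lt_def yn rdot_ge0.
  rewrite -ler_pdivlMr//; apply: ge_sup; first exact: hs.1.
  by move=> m hm; rewrite ler_pdivlMr.
pose C1 := CP + 1 - l.
pose C2 := 2 * CP + 2 * CQ.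
have CP0 := PC.1; have CQ0 := QC.1.
have C10 : 0 <= C1 by rewrite /C1; lra.
have C20 : 0 <= C2 by rewrite /C2; lra.
have m_form : psd_form (fun u v => d u v - l * rdot u v).
  have sP := self_adjoint_form Psa; have sQ := self_adjoint_form Qsa.
  split; last by move=> u; rewrite subr_ge0.
  split=> [u v|u v w|a u w]; rewrite /d.
  - by rewrite (rdotC u v) (self_adjoint_rdot Psa) (self_adjoint_rdot Qsa) !(rdotC u).
  - by rewrite (formDl sP) (formDl sQ) rdotDl; ring.
  - by rewrite (formZl sP) (formZl sQ) rdotZl; ring.
(* Letting [h] tend to 0 contradicts [l < 0]. Concretely, [h = l ^+ 4 / D] makes the right-hand side
   less than [l ^+ 4]; if this [h] exceeds [- l / 2], then [- l / 2] is smaller still and does the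
   same. *)
suff key : forall h, 0 < h -> h <= - l / 2 -> l ^+ 4 <= 4 * (h * C1 * C2).
  have l4 : 0 < l ^+ 4 by rewrite exprn_even_gt0//= lt_eqF.
  pose D := 8 * (C1 * C2 + 1).
  have D0 : 0 < D by rewrite /D; nra.
  have [h1|h1] := leP (l ^+ 4 / D) (- l / 2).
    have := key (l ^+ 4 / D) (divr_gt0 l4 D0) h1.
    have : 0 < l ^+ 4 / D by exact: divr_gt0.
    have : l ^+ 4 / D * D = l ^+ 4 by rewrite mulfVK// gt_eqF.
    by rewrite {2}/D; nra.
  have l2 : 0 < - l / 2 by lra.
  have := key _ l2 (lexx _).
  have : l ^+ 4 / D * D = l ^+ 4 by rewrite mulfVK// gt_eqF.
  have : 0 <= C1 * C2 by exact: mulr_ge0.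
  by rewrite {2}/D; nra.
move=> h h0 hl.
have [y hy] : exists y, d y y < (l + h) * rdot y y.
  apply/not_existsP => hn.
  have : lower (l + h) by move=> y; rewrite leNgt; apply/negP/hn.
  by move=> /(ub_le_sup hs.2); rewrite -/l; lra.
have ny0 : 0 < rdot y y.
  rewrite lt_def rdot_ge0 andbT; apply/eqP => n0.
  by have := ln y; move: hy; rewrite n0 !mulr0; lra.
pose n := rdot y y.
(* The residual of the near eigenvector. Cauchy-Schwarz for the positive form of [P - Q - l],
   applied to [y] and [z], bounds [|z|^4] by [h n] times [C1 |z|^2]. *)
pose z := P y - Q y - l%:C *: y.
have zE v : rdot z v = d y v - l * rdot y v.
  by rewrite /z !(formBl rdot_symmetric) rdotZl.
have nz : rdot z z <= h * n * C1.
  have := psd_CauchySchwarz m_form y z; rewrite -zE.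
  have := rbounded_form z PC; have := Q0 z; have := rdot_ge0 z.
  rewrite le_eqVlt => /orP[/eqP <- _ _ _|z0].
    by rewrite !mulr_ge0// ltW.
  move=> qz pz cs.
  rewrite -(ler_pM2l z0) -expr2 (le_trans cs)//.
  have mz : d z z - l * rdot z z <= C1 * rdot z z by rewrite /d /C1; lra.
  have my : d y y - l * rdot y y <= h * n by rewrite /n; lra.
  have m1 := psd_ge0 m_form y; have m2 := psd_ge0 m_form z.
  have -> : rdot z z * (h * n * C1) = (h * n) * (C1 * rdot z z) by ring.
  exact: ler_pM.
pose s := rdot (P y) y + rdot (Q y) y.
have zS : - l * s <= rdot z (P y + Q y).
  have -> : rdot z (P y + Q y) =
      rdot (P y) (P y) - rdot (Q y) (Q y) - l * s.
    rewrite zE /d !(formDr rdot_symmetric) /s !(rdotC y) (rdotC (Q y) (P y)).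
    by ring.
  by have := QP y; lra.
have sn : - l / 2 * n <= s.
  have := P0 y; have := hy; rewrite /s /d -/n.
  have : (l + h) * n <= l / 2 * n by rewrite ler_pM2r//; lra.
  by lra.
have nS : rdot (P y + Q y) (P y + Q y) <= C2 * n.
  have := psd_sqrD_le rdot_psd (P y) (Q y).
  by have := PC.2 y; have := QC.2 y; rewrite /C2 -/n; lra.
have := psd_CauchySchwarz rdot_psd z (P y + Q y) => cs.
have lln : l ^+ 2 / 2 * n <= rdot z (P y + Q y).
  apply: le_trans zS.
  have -> : l ^+ 2 / 2 * n = - l * (- l / 2 * n) by field.
  by apply: ler_wpM2l sn; lra.
have n0 : 0 < n ^+ 2 by exact: exprn_gt0.
rewrite -(ler_pM2r n0).
have -> : l ^+ 4 * n ^+ 2 = 4 * (l ^+ 2 / 2 * n) ^+ 2 by field.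
have -> : 4 * (h * C1 * C2) * n ^+ 2 = 4 * (h * n * C1 * (C2 * n)) by ring.
rewrite ler_pM2l//.
apply: (@le_trans _ _ (rdot z (P y + Q y) ^+ 2)).
  rewrite ler_pXn2r// nnegrE.
    by rewrite mulr_ge0 ?divr_ge0 ?sqr_ge0// ltW.
  by apply: le_trans lln; rewrite mulr_ge0 ?divr_ge0 ?sqr_ge0// ltW.
apply: le_trans cs _.
by apply: ler_pM => //; exact: rdot_ge0.
Qed.

End form_sqrt_monotone.

(** * Trace of a positive form *)

Section orthonormal_expansions.
Context {R : realType} {H : hilbertType R}.
Implicit Types (x y z u v w f g : H) (V X : set H) (Y : seq H).

Lemma closed_rdotP V :
  (forall f, (forall e : R, 0 < e -> exists2 g, V g & rdot (f - g) (f - g) < e) ->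
             V f) -> closed V.
Proof.
move=> hV f cf; apply: hV => e e0.
have se0 : 0 < (Num.sqrt e)%:C :> R[i] by rewrite ltcR sqrtr_gt0.
have [g [Vg]] := cf _ (nbhsx_ballx f _ se0).
rewrite -ball_normE/= normE ltcR ltr_sqrt// => h.
by exists g.
Qed.

Definition proj_seq Y f := \sum_(e <- Y) dotp f e *: e.

Lemma proj_seqE a Y f g :
  proj_seq Y (a *: f + g) = a *: proj_seq Y f + proj_seq Y g.
Proof.
rewrite /proj_seq scaler_sumr -big_split/=; apply: eq_bigr => e _.
by rewrite dotp_linear scalerDl scalerA.
Qed.

Lemma rdotZZ (a : R[i]) f :
  rdot (a *: f) (a *: f) = (complex.Re a ^+ 2 + complex.Im a ^+ 2) * rdot f f.
Proof.
rewrite {1}/rdot dotpZl dotpZr rdot_norm; case: a => p q /=; ring.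
Qed.

Section basis.
Variable X : set H.
Hypothesis Xb : orthonormal_basis X.

Lemma proj_seq_dist Y f : uniq Y -> (forall e, e \in Y -> X e) ->
  rdot (f - proj_seq Y f) (f - proj_seq Y f) <= rdot f f.
Proof.
move=> uY YX; have [X1 X0 _] := Xb.
pose s := \sum_(e <- Y) dotp f e * (dotp f e)^*.
have fP : dotp (proj_seq Y f) f = s.
  by rewrite dotp_suml; apply: eq_bigr => e _; rewrite dotpZl -dotp_conj.
have PP : dotp (proj_seq Y f) (proj_seq Y f) = s.
  rewrite {1}/proj_seq dotp_suml big_seq [RHS]big_seq; apply: eq_bigr => e eY.
  rewrite dotpZl; congr (_ * _); rewrite dotp_conj; congr (_^*).
  rewrite /proj_seq dotp_suml (bigD1_seq e)//= dotpZl (X1 _ (YX _ eY)) mulr1.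
  rewrite big_seq_cond big1 ?addr0// => e' /andP[e'Y e'e].
  by rewrite dotpZl (X0 _ _ (YX _ e'Y) (YX _ eY) e'e) mulr0.
rewrite (form_sqrB rdot_symmetric) rdotC /rdot fP PP.
have : 0 <= complex.Re s.
  rewrite raddf_sum; apply: sumr_ge0 => e _.
  by case: (dotp f e) => p q /=; nra.
by lra.
Qed.

(** Convergence of the expansion along the net of finite subsets of [X]. Asking for all larger [Y']
    allows the sets obtained for two vectors to be merged, so that [V] is a closed subspace; it
    contains [X], hence is everything. *)
Let V := [set f | forall eps : R, 0 < eps -> exists Y,
  [/\ uniq Y, forall e, e \in Y -> X e & forall Y', uniq Y' ->
     (forall e, e \in Y' -> X e) -> {subset Y <= Y'} ->
     rdot (f - proj_seq Y' f) (f - proj_seq Y' f) <= eps]].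

Let V_all f : V f.
Proof.
have [X1 X0 Xs] := Xb.
suff : [set: H] `<=` V by exact.
rewrite -Xs; apply: smallest_sub; last first.
  move=> e Xe eps eps0; exists [:: e]; split=> //.
    by move=> e'; rewrite inE => /eqP ->.
  move=> Y uY YX /(_ e); rewrite inE eqxx => /(_ isT) eY.
  rewrite /proj_seq (bigD1_seq e)//= (X1 _ Xe) scale1r big_seq_cond big1.
    by rewrite addr0 subrr (form0l rdot_symmetric) ltW.
  by move=> e' /andP[/YX Xe' e'e]; rewrite (X0 e e') ?scale0r// eq_sym.
split.
- apply: closed_rdotP => g hg eps eps0.
  have [h Vh gh] := hg (eps / 4) (divr_gt0 eps0 (ltr0n _ 4)).
  have [Y [uY YX hY]] := Vh (eps / 4) (divr_gt0 eps0 (ltr0n _ 4)).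
  exists Y; split=> // Y' uY' Y'X YY'.
  have h1 := proj_seq_dist (g - h) uY' Y'X.
  have h2 := hY _ uY' Y'X YY'.
  have := psd_sqrD_le rdot_psd (g - h - proj_seq Y' (g - h)) (h - proj_seq Y' h).
  have -> : g - h - proj_seq Y' (g - h) + (h - proj_seq Y' h) = g - proj_seq Y' g.
    have -> : proj_seq Y' g = proj_seq Y' (g - h) + proj_seq Y' h.
      by have := proj_seqE 1 Y' (g - h) h; rewrite !scale1r subrK.
    by rewrite opprD addrACA subrK.
  by move=> h3; lra.
- move=> eps eps0; exists [::]; split=> // Y _ _ _.
  rewrite /proj_seq big1 ?subrr ?(form0l rdot_symmetric) ?ltW//.
  by move=> e _; rewrite dot0p scale0r.
- move=> a u v Vu Vv eps eps0.
  pose a2 := complex.Re a ^+ 2 + complex.Im a ^+ 2.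
  have a20 : 0 <= a2 by rewrite addr_ge0// sqr_ge0.
  have d0 : 0 < 4 * (a2 + 1) by lra.
  have [Y1 [uY1 Y1X h1]] := Vu (eps / (4 * (a2 + 1))) (divr_gt0 eps0 d0).
  have [Y2 [uY2 Y2X h2]] := Vv (eps / 4) (divr_gt0 eps0 (ltr0n _ 4)).
  exists (undup (Y1 ++ Y2)); split; first exact: undup_uniq.
    by move=> e; rewrite mem_undup mem_cat => /orP[/Y1X|/Y2X].
  move=> Y uY YX sY.
  have /h1 {}h1 : {subset Y1 <= Y}.
    by move=> e eY; apply: sY; rewrite mem_undup mem_cat eY.
  have /h2 {}h2 : {subset Y2 <= Y}.
    by move=> e eY; apply: sY; rewrite mem_undup mem_cat eY orbT.
  rewrite proj_seqE opprD addrACA -scalerBr.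
  apply: le_trans (psd_sqrD_le rdot_psd _ _) _; rewrite rdotZZ -/a2.
  have {}h1 := h1 uY YX; have {}h2 := h2 uY YX.
  have : a2 * rdot (u - proj_seq Y u) (u - proj_seq Y u) <= eps / 4.
    apply: le_trans (ler_wpM2l a20 h1) _.
    have -> : a2 * (eps / (4 * (a2 + 1))) = eps / 4 * (a2 / (a2 + 1)).
      by field; rewrite gt_eqF//; lra.
    rewrite ler_piMr ?divr_ge0 ?(ltW eps0)// ler_pdivrMr; lra.
  by lra.
Qed.

Lemma basis_approx (J : nat) (f : nat -> H) (eps : R) : 0 < eps ->
  exists Y, [/\ uniq Y, forall e, e \in Y -> X e
    & forall j, (j < J)%N ->
      rdot (f j - proj_seq Y (f j)) (f j - proj_seq Y (f j)) <= eps].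
Proof.
move=> eps0.
suff [Y [uY YX hY]] : exists Y, [/\ uniq Y, forall e, e \in Y -> X e & forall Y',
    uniq Y' -> (forall e, e \in Y' -> X e) -> {subset Y <= Y'} ->
    forall j, (j < J)%N ->
     rdot (f j - proj_seq Y' (f j)) (f j - proj_seq Y' (f j)) <= eps].
  by exists Y; split=> //; exact: hY.
elim: J => [|J [Y1 [uY1 Y1X h1]]]; first by exists [::].
have [Y2 [uY2 Y2X h2]] := V_all (f J) eps0.
exists (undup (Y1 ++ Y2)); split; first exact: undup_uniq.
  by move=> e; rewrite mem_undup mem_cat => /orP[/Y1X|/Y2X].
move=> Y uY YX sY j; rewrite ltnS leq_eqVlt => /orP[/eqP ->|jJ].
  by apply: h2 => // e eY; apply: sY; rewrite mem_undup mem_cat eY orbT.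
by apply: h1 => // e eY; apply: sY; rewrite mem_undup mem_cat eY.
Qed.

End basis.

(** A complex orthonormal family together with its multiples by ['i] is orthonormal for [rdot], and
    real expansions over it recover the complex ones. The price is a doubled trace. *)
Definition realify Y := Y ++ [seq 'i *: e | e <- Y].

Lemma proj_seq_realify Y f :
  proj_seq Y f = \sum_(e <- realify Y) (rdot f e)%:C *: e.
Proof.
rewrite /realify big_cat/= big_map -big_split/=; apply: eq_bigr => e _ /=.
rewrite scalerA -scalerDl {2}/rdot dotpZr /rdot; congr (_ *: _).
by case: (dotp f e) => p q; apply/eqP; rewrite eq_complex /=; apply/andP; split; apply/eqP; ring.
Qed.

(* Expand [0 <= \sum_(e <- Y) k (e - Q e) (e - Q e)] where [Q] is the sum of
   the [<., f j> f j]. *)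
Lemma form_trace_le (k : H -> H -> R) (C : R) (Y : seq H) (J : nat)
    (f : nat -> H) (eps : R) :
  psd_form k -> 0 < C -> (forall x, k x x <= C * rdot x x) ->
  (forall i j, (i < J)%N -> (j < J)%N -> i != j -> rdot (f i) (f j) = 0) ->
  (forall j, (j < J)%N -> rdot (f j) (f j) <= 1) ->
  0 < eps ->
  (forall j, (j < J)%N -> let d := f j - \sum_(e <- Y) (rdot (f j) e)%:C *: e in
     rdot d d <= eps ^+ 2) ->
  \sum_(j < J) k (f j) (f j) <=
    \sum_(e <- Y) k e e + (2 * J%:R + J%:R ^+ 2) * (C * eps).
Proof.
move=> kp C0 kC fo f1 eps0 fY.
have ks := kp.1; have kc x y : k x y = k y x by case: ks.
pose g j := \sum_(e <- Y) (rdot (f j) e)%:C *: e.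
have kff i j : (i < J)%N -> (j < J)%N -> `|k (f i) (f j)| <= C.
  move=> iJ jJ; rewrite -(@ler_pXn2r _ 2)// ?nnegrE ?(ltW C0)// real_normK ?num_real//.
  apply: le_trans (psd_CauchySchwarz kp _ _) _; rewrite expr2.
  apply: ler_pM; try exact: psd_ge0.
    by apply: le_trans (kC _) _; have := f1 _ iJ; nra.
  by apply: le_trans (kC _) _; have := f1 _ jJ; nra.
have kgf j : (j < J)%N -> k (f j) (f j) - C * eps <= k (g j) (f j).
  move=> jJ.
  have : `|k (f j - g j) (f j)| <= C * eps.
    have Ce : 0 < C * eps by exact: mulr_gt0.
    rewrite -(@ler_pXn2r _ 2)// ?nnegrE ?(ltW Ce)// real_normK ?num_real//.
    apply: le_trans (psd_CauchySchwarz kp _ _) _.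
    have -> : (C * eps) ^+ 2 = (C * eps ^+ 2) * C by ring.
    apply: ler_pM; try exact: psd_ge0.
      by apply: le_trans (kC _) _; have := fY _ jJ; rewrite /= -/(g j) => ?;
        rewrite ler_pM2l.
    by apply: le_trans (kC _) _; have := f1 _ jJ; nra.
  rewrite (formBl ks) ler_norml => /andP[]; lra.
have gf i j : (i < J)%N -> (j < J)%N ->
    `|rdot (g i) (f j) - rdot (f i) (f j)| <= eps.
  move=> iJ jJ; rewrite -(formBl rdot_symmetric).
  rewrite -(@ler_pXn2r _ 2)// ?nnegrE ?(ltW eps0)// real_normK ?num_real//.
  apply: le_trans (psd_CauchySchwarz rdot_psd _ _) _.
  rewrite -[leRHS]mulr1; apply: ler_pM; try exact: rdot_ge0.
    rewrite -opprB (formNl rdot_symmetric) (formNr rdot_symmetric) opprK.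
    exact: fY.
  exact: f1.
pose Q e := \sum_(j < J) (rdot (f j) e)%:C *: f j.
have h0 : 0 <= \sum_(e <- Y) k (e - Q e) (e - Q e).
  by apply: sumr_ge0 => e _; exact: psd_ge0.
have h1 : \sum_(e <- Y) k e (Q e) = \sum_(j < J) k (g j) (f j).
  under eq_bigr => e _.
    rewrite /Q (form_sumr ks).
    under eq_bigr => j _ do rewrite (formZr ks).
    over.
  rewrite exchange_big/=; apply: eq_bigr => j _.
  by rewrite /g (form_suml ks); apply: eq_bigr => e _; rewrite (formZl ks).
have h2 : \sum_(e <- Y) k (Q e) (Q e) =
    \sum_(i < J) \sum_(j < J) rdot (g i) (f j) * k (f i) (f j).
  under eq_bigr => e _.
    rewrite /Q (form_suml ks).
    under eq_bigr => i _.
      rewrite (formZl ks) (form_sumr ks) mulr_sumr.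
      under eq_bigr => j _ do rewrite (formZr ks) mulrA.
      over.
    over.
  rewrite exchange_big/=; apply: eq_bigr => i _.
  rewrite exchange_big/=; apply: eq_bigr => j _.
  rewrite /g (form_suml rdot_symmetric) mulr_suml; apply: eq_bigr => e _.
  by rewrite rdotZl (rdotC e).
have h3 : \sum_(e <- Y) k (e - Q e) (e - Q e) = \sum_(e <- Y) k e e -
    2 * \sum_(j < J) k (g j) (f j) +
    \sum_(i < J) \sum_(j < J) rdot (g i) (f j) * k (f i) (f j).
  rewrite -h1 -h2 mulr_sumr -sumrB -big_split/=; apply: eq_bigr => e _.
  exact: form_sqrB.
have h4 : \sum_(j < J) k (f j) (f j) - J%:R * (C * eps) <=
    \sum_(j < J) k (g j) (f j).
  rewrite mulr_natl -[J in _ *+ J]card_ord -sumr_const -sumrB.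
  by apply: ler_sum => j _; exact: kgf.
have h5 : \sum_(i < J) \sum_(j < J) rdot (g i) (f j) * k (f i) (f j) <=
    \sum_(i < J) (k (f i) (f i) + J%:R * (C * eps)).
  apply: ler_sum => i _.
  rewrite -[k (f i) (f i)]mul1r mulr_natl -[J in _ *+ J]card_ord -sumr_const.
  rewrite -lerBlDl.
  apply: (@le_trans _ _ (\sum_(j < J) ((rdot (g i) (f j) - rdot (f i) (f j)) *
     k (f i) (f j)))).
    under [leRHS]eq_bigr => j _ do rewrite mulrBl.
    rewrite sumrB lerD2l lerN2 (bigD1 i)//= big1 ?addr0.
      by rewrite ler_wpM2r ?(psd_ge0 kp)// f1.
    by move=> j ji; rewrite fo ?mul0r// eq_sym.
  apply: ler_sum => j _; apply: le_trans (ler_norm _) _; rewrite normrM mulrC.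
  by apply: ler_pM => //; [exact: kff|exact: gf].
(* With [T] the sum of the [k (f j) (f j)], the expansion reads [0 <= \sum k e e - 2 (T - J C eps) +
   (T + J^2 C eps)], which is where [2 J + J^2] comes from. *)
move: h5; rewrite big_split/= sumr_const card_ord -mulr_natl => h5.
move: h0; rewrite h3; move: h4 h5.
set T := \sum_(j < J) k (f j) (f j).
by rewrite expr2; lra.
Qed.

End orthonormal_expansions.

(** * Projection-valued measures *)

Section projection_valued_measures.
Context {R : realType} {H : hilbertType R} (E : pvm H).
Implicit Types (x y u v : H) (B C : set (measurableTypeR R)).

Let Eform B (mB : measurable B) := self_adjoint_form (pvm_self_adjoint E mB).

Lemma pvm_rdot B x y : measurable B -> rdot (E B x) y = rdot x (E B y).
Proof. by move=> mB; exact: self_adjoint_rdot (pvm_self_adjoint E mB) _ _. Qed.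

Lemma pvm_idem B x : measurable B -> E B (E B x) = E B x.
Proof. by move=> mB; rewrite -pvm_setI// setIid. Qed.

Lemma pvm_orth B C x y : measurable B -> measurable C -> B `&` C = set0 ->
  rdot (E B x) (E C y) = 0.
Proof.
move=> mB mC BC; rewrite pvm_rdot// -pvm_setI// BC pvm_set0.
exact: form0r rdot_symmetric _.
Qed.

Lemma scalar_measure_rdot u B : measurable B ->
  scalar_measure E u B = (rdot (E B u) u)%:E.
Proof. exact: scalar_measureE. Qed.

Lemma scalar_measure_sqr u B : measurable B ->
  scalar_measure E u B = (rdot (E B u) (E B u))%:E.
Proof.
by move=> mB; rewrite scalar_measure_rdot// -[in LHS](pvm_idem u mB) pvm_rdot.
Qed.

Lemma pvm_sqr_le B u : measurable B -> rdot (E B u) (E B u) <= rdot u u.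
Proof.
move=> mB; rewrite -lee_fin -scalar_measure_sqr//.
have -> : (rdot u u)%:E = scalar_measure E u setT.
  by rewrite scalar_measure_rdot// pvm_setT.
by apply: le_measure => //; rewrite inE.
Qed.

(** Additivity of the scalar measures gives equality of quadratic forms; polarization upgrades it to
    vectors. *)
Lemma pvm_setU B C u : measurable B -> measurable C -> B `&` C = set0 ->
  E (B `|` C) u = E B u + E C u.
Proof.
move=> mB mC BC; have mBC : measurable (B `|` C) by exact: measurableU.
have q v : rdot (E (B `|` C) v) v = rdot (E B v) v + rdot (E C v) v.
  apply: EFin_inj; rewrite EFinD -!scalar_measure_rdot//.
  by rewrite measureU.
apply: rdot_inj => z; rewrite rdotDl.
have := q (u + z); have := q u; have := q z.
rewrite (form_sqrD (Eform mBC)) (form_sqrD (Eform mB)) (form_sqrD (Eform mC)).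
by lra.
Qed.

Lemma pvm_setC B u : measurable B -> E (~` B) u = u - E B u.
Proof.
move=> mB; have mC := measurableC mB.
apply/eqP; rewrite eq_sym subr_eq; apply/eqP.
by rewrite -pvm_setU// ?setCI// ?setICl// setUC setUv pvm_setT.
Qed.

Lemma pvm_subset B C u : measurable B -> measurable C -> B `<=` C ->
  E C (E B u) = E B u.
Proof. by move=> mB mC BC; rewrite -pvm_setI// setIC (setIidl BC). Qed.

Section spectral.
Variable T : H -> H.
Hypotheses (TE : spectral_pvm T E) (Tsa : self_adjoint T).

Let sT := self_adjoint_form Tsa.

Lemma spectral_rdot u : rdot (T u) u = \int[scalar_measure E u]_l l.
Proof. by rewrite /rdot (TE u).2. Qed.

(** The hypothesis kills the cross terms of the scalar measures, so the measure of [u + v] is the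
    sum of those of [u] and [v]. Integrating, the quadratic form of [T] is additive on this pair,
    hence its mixed term vanishes. This extracts operator information from a spectral theorem stated
    for quadratic forms. *)
Lemma spectral_rdotD u v :
  (forall B, measurable B -> rdot (E B u) v = 0) -> rdot (T u) v = 0.
Proof.
move=> uv.
have h : rdot (T (u + v)) (u + v) = rdot (T u) u + rdot (T v) v.
  rewrite !spectral_rdot /Rintegral -fineD; last 2 first.
  - exact: integrable_fin_num (TE u).1.
  - exact: integrable_fin_num (TE v).1.
  congr fine; rewrite -(integral_measure_add _ (TE u).1 (TE v).1)//.
  apply: eq_measure_integral => B mB _.
  rewrite /measure_add/= /msum !big_ord_recl big_ord0/= adde0.
  rewrite !scalar_measure_rdot// -EFinD; congr EFin.
  by rewrite (form_sqrD (Eform mB)) uv// mulr0 addr0.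
by move: h; rewrite (form_sqrD sT); lra.
Qed.

Lemma spectral_commute B u : measurable B -> T (E B u) = E B (T (E B u)).
Proof.
move=> mB; apply/eqP; rewrite -subr_eq0 -pvm_setC//; apply/eqP/rdot_eq0.
have mC := measurableC mB.
rewrite pvm_rdot// pvm_idem//; apply: spectral_rdotD => C mCC.
rewrite -(pvm_setI E mCC mB) pvm_orth//; first exact: measurableI.
by rewrite -setIA setICr setI0.
Qed.

Lemma spectral_commutes B u : measurable B -> T (E B u) = E B (T u).
Proof.
move=> mB; rewrite -[u in RHS](subrK (E B u)) -pvm_setC//.
rewrite (self_adjointD Tsa) raddfD/= -spectral_commute//.
rewrite (spectral_commute _ (measurableC mB)) -pvm_setI ?setICr//.
  by rewrite pvm_set0 add0r.
exact: measurableC.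
Qed.

Lemma spectral_concentrated B u : measurable B -> E B u = u ->
  (scalar_measure E u).-integrable B (fun l => l%:E) /\
  rdot (T u) u = \int[scalar_measure E u]_(l in B) l.
Proof.
move=> mB Bu; have iT := (TE u).1; split; first exact: integrableS iT.
have mC := measurableC mB.
have N0 : scalar_measure E u (~` B) = 0%E.
  by rewrite scalar_measure_rdot// -Bu -pvm_setI// setICl pvm_set0 /rdot dot0p.
by rewrite spectral_rdot /Rintegral (negligible_integral mC measurableT iT N0) setTD setCK.
Qed.

Lemma spectral_ge B u c : measurable B -> E B u = u -> (forall l, B l -> c <= l) ->
  c * rdot u u <= rdot (T u) u.
Proof.
move=> mB Bu Bc; have [iB ->] := spectral_concentrated mB Bu.
have -> : c * rdot u u = \int[scalar_measure E u]_(l in B) c.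
  by rewrite Rintegral_cst// [X in fine X](scalar_measure_rdot u mB) Bu.
by apply: le_Rintegral => //; exact: finite_measure_integrable_cst.
Qed.

Lemma spectral_le B u c : measurable B -> E B u = u -> (forall l, B l -> l <= c) ->
  rdot (T u) u <= c * rdot u u.
Proof.
move=> mB Bu Bc; have [iB ->] := spectral_concentrated mB Bu.
have -> : c * rdot u u = \int[scalar_measure E u]_(l in B) c.
  by rewrite Rintegral_cst// [X in fine X](scalar_measure_rdot u mB) Bu.
by apply: le_Rintegral => //; exact: finite_measure_integrable_cst.
Qed.

(* Cauchy-Schwarz for the form of [T - c] on the range of [E B], where it lies
   between [0] and [delta]. *)
Lemma spectral_near B u (c delta : R) : measurable B -> E B u = u ->
  (forall l, B l -> c <= l <= c + delta) ->
  rdot (T u - c%:C *: u) (T u - c%:C *: u) <= delta ^+ 2 * rdot u u.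
Proof.
move=> mB Bu Bc; pose z := T u - c%:C *: u; rewrite -/z.
have Bz : E B z = z.
  by rewrite raddfB/= (self_adjointZ (pvm_self_adjoint E mB)) -spectral_commutes// Bu.
have m_ge0 v : E B v = v -> 0 <= rdot (T v) v - c * rdot v v.
  move=> Bv; rewrite subr_ge0; apply: spectral_ge Bv _ => // l Bl.
  by have /andP[] := Bc l Bl.
have m_le v : E B v = v -> rdot (T v) v - c * rdot v v <= delta * rdot v v.
  move=> Bv; have : rdot (T v) v <= (c + delta) * rdot v v.
    by apply: spectral_le Bv _ => // l Bl; have /andP[] := Bc l Bl.
  by rewrite mulrDl; lra.
(* Compressing by [E B] makes the form of [T - c] positive on all of [H], so that the general
   Cauchy-Schwarz inequality applies. *)
pose m x y := rdot (T (E B x)) (E B y) - c * rdot (E B x) (E B y).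
have mp : psd_form m.
  split; last by move=> x; apply: m_ge0; exact: pvm_idem.
  split=> [x y|x y w|a x w]; rewrite /m.
  - by rewrite (self_adjoint_rdot Tsa) !(rdotC (E B x)).
  - by rewrite raddfD/= (formDl sT) rdotDl; ring.
  - rewrite (self_adjointZ (pvm_self_adjoint E mB)) (formZl sT) rdotZl; ring.
have zE : rdot z z = m u z.
  by rewrite /m Bu Bz {1}/z (formBl rdot_symmetric) rdotZl.
have := psd_CauchySchwarz mp u z; rewrite -zE => cs.
have [->|z0] := eqVneq (rdot z z) 0; first by rewrite mulr_ge0 ?sqr_ge0 ?rdot_ge0.
have zp : 0 < rdot z z by rewrite lt_def z0 rdot_ge0.
rewrite -(ler_pM2l zp) -expr2 (le_trans cs)//.
have -> : rdot z z * (delta ^+ 2 * rdot u u) =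
  (delta * rdot u u) * (delta * rdot z z) by ring.
apply: ler_pM; try exact: psd_ge0.
  by rewrite /m Bu; exact: m_le.
by rewrite /m Bz; exact: m_le.
Qed.

End spectral.
End projection_valued_measures.

(** * Positive and negative parts of a trace-class operator *)

Section trace_class_operators.
Context {R : realType} {H : hilbertType R}.
Implicit Types (P Q : H -> H).

(** A trace bound free of bases, tested on finite orthogonal families in the unit ball.
    Orthogonality is only that of [rdot], so a vector and its multiple by ['i] may both occur. *)
Definition trace_bounded P (tau : R) := forall (J : nat) (f : nat -> H),
  (forall i j, (i < J)%N -> (j < J)%N -> i != j -> rdot (f i) (f j) = 0) ->
  (forall j, (j < J)%N -> rdot (f j) (f j) <= 1) ->
  \sum_(j < J) rdot (P (f j)) (f j) <= tau.

Lemma trace_bounded_le P Q tau : (forall x, rdot (Q x) x <= rdot (P x) x) ->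
  trace_bounded P tau -> trace_bounded Q tau.
Proof.
move=> QP Pt J f f0 f1; apply: le_trans (Pt J f f0 f1).
by apply: ler_sum => j _; exact: QP.
Qed.

Lemma positive_operator_psd P : positive_operator P ->
  psd_form (fun x y => rdot (P x) y).
Proof.
move=> [Psa P0]; split; first exact: self_adjoint_form.
by move=> x; have := P0 x; rewrite /rdot; case: (dotp _ _) => a b; rewrite lecE => /andP[].
Qed.

(** Finitely many [f j] are expanded in the basis up to a small error, and [form_trace_le] compares
    the sums. The resulting bound is twice the trace, because the real family [realify Y] counts
    each basis vector twice. *)
Lemma trace_boundedP (P : {linear H -> H}) (X : set H) :
  bounded_operator P -> positive_operator P -> orthonormal_basis X ->
  (\esum_(e in X) (complex.Re (dotp (P e) e))%:E < +oo)%E ->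
  exists tau, trace_bounded P tau.
Proof.
move=> Pb Pp Xb; have kp := positive_operator_psd Pp.
set t := (\esum_(e in X) _)%E => too.
have [C PC] := bounded_operatorP Pb.
have t0 : (0 <= t)%E by apply: esum_ge0 => e _; rewrite lee_fin (psd_ge0 kp).
have sumY Y : uniq Y -> (forall e, e \in Y -> X e) ->
    \sum_(e <- Y) rdot (P e) e <= fine t.
  move=> uY YX; rewrite -lee_fin fineK ?ge0_fin_numE// -sumEFin.
  apply: esum_ge; exists [set` Y].
    by split; [exact: finite_seq|move=> e; exact: YX].
  by rewrite -fsbig_seq.
exists (2 * fine t) => J f f0 f1.
have D0 : 0 < (2 * J%:R + J%:R ^+ 2) * (C + 1) + 1 :> R.
  have := PC.1; have : 0 <= J%:R :> R by exact: ler0n.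
  by move=> J0 C0; rewrite ltr_wpDl// mulr_ge0 ?addr_ge0 ?mulr_ge0 ?sqr_ge0.
apply/ler_addgt0Pr => eps eps0.
pose d := eps / ((2 * J%:R + J%:R ^+ 2) * (C + 1) + 1).
have d0 : 0 < d by exact: divr_gt0.
have [Y [uY YX hY]] := basis_approx Xb J f (exprn_gt0 2 d0).
have C1 : 0 < C + 1 by rewrite ltr_wpDl// PC.1.
have := @form_trace_le _ _ _ _ (realify Y) J f d kp C1
  (fun x => rbounded_form x PC) f0 f1 d0.
move=> /(_ _)/le_trans; apply.
  by move=> j jJ /=; rewrite -proj_seq_realify; exact: hY.
have -> : \sum_(e <- realify Y) rdot (P e) e = 2 * \sum_(e <- Y) rdot (P e) e.
  rewrite /realify big_cat/= big_map mulr2n mulrDl mul1r; congr (_ + _).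
  apply: eq_bigr => e _; rewrite linearZ/= /rdot dotpZl dotpZr.
  by case: (dotp _ _) => a b /=; ring.
apply: lerD; first by rewrite ler_pM2l ?sumY.
have -> : (2 * J%:R + J%:R ^+ 2) * ((C + 1) * d) =
    (2 * J%:R + J%:R ^+ 2) * (C + 1) * d by ring.
by rewrite /d mulrA ler_pdivrMr// mulrC ler_pM2l// lerDl.
Qed.

End trace_class_operators.

(** * The two parts of [K], their positivity and their trace *)

Section spectral_parts.
Context {R : realType} {H : hilbertType R}.
Variables (K : {linear H -> H}) (EK : pvm H).
Hypotheses (Ksa : self_adjoint K) (KE : spectral_pvm K EK).
Variable C : R.
Hypothesis KC : rbounded K C.

Let pos : set (measurableTypeR R) := `]0, +oo[%classic.
Let neg : set (measurableTypeR R) := `]-oo, 0[%classic.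
Let zer : set (measurableTypeR R) := [set 0].

Let mpos : measurable pos. Proof. exact: measurable_itv. Qed.
Let mneg : measurable neg. Proof. exact: measurable_itv. Qed.
Let mzer : measurable zer. Proof. exact: measurable_set1. Qed.

Let pos_neg : pos `&` neg = set0.
Proof.
rewrite -subset0 => x []; rewrite /pos /neg /= !in_itv/= andbT => x0 x1.
by have := lt_trans x0 x1; rewrite ltxx.
Qed.

Lemma positive_part_self_adjoint : self_adjoint (positive_part K EK).
Proof.
move=> u v; rewrite /positive_part Ksa (pvm_self_adjoint EK mpos).
by rewrite -(spectral_commutes KE Ksa).
Qed.

Lemma negative_part_self_adjoint : self_adjoint (negative_part K EK).
Proof.
move=> u v; rewrite /negative_part dotpNl -[- K _]add0r dotpBr.
rewrite (dotp_conj 0) dot0p rmorph0 sub0r; congr (- _).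
rewrite Ksa (pvm_self_adjoint EK mneg).
by rewrite -(spectral_commutes KE Ksa).
Qed.

Lemma positive_part_psd : psd_form (fun x y => rdot (positive_part K EK x) y).
Proof.
split; first exact: self_adjoint_form positive_part_self_adjoint.
move=> x; rewrite /positive_part (spectral_commute KE Ksa x mpos) pvm_rdot//.
have := spectral_ge KE mpos (pvm_idem EK x mpos) (c := 0).
by rewrite mul0r; apply => l; rewrite /pos/= in_itv/= andbT => /ltW.
Qed.

Lemma negative_part_psd : psd_form (fun x y => rdot (negative_part K EK x) y).
Proof.
split; first exact: self_adjoint_form negative_part_self_adjoint.
move=> x; rewrite /negative_part (formNl rdot_symmetric) oppr_ge0.
rewrite (spectral_commute KE Ksa x mneg) pvm_rdot//.
have := spectral_le KE mneg (pvm_idem EK x mneg) (c := 0).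
by rewrite mul0r; apply => l; rewrite /neg/= in_itv/= => /ltW.
Qed.

Let rdotNN (x : H) : rdot (- x) (- x) = rdot x x.
Proof. by rewrite (formNl rdot_symmetric) (formNr rdot_symmetric) opprK. Qed.

Lemma positive_part_bounded : rbounded (positive_part K EK) C.
Proof.
split=> [|x]; first exact: KC.1.
by apply: le_trans (KC.2 _) _; rewrite ler_wpM2l ?KC.1 ?pvm_sqr_le.
Qed.

Lemma negative_part_bounded : rbounded (negative_part K EK) C.
Proof.
split=> [|x]; first exact: KC.1.
rewrite /negative_part rdotNN.
by apply: le_trans (KC.2 _) _; rewrite ler_wpM2l ?KC.1 ?pvm_sqr_le.
Qed.

Let K_zer x : K (EK zer x) = 0.
Proof.
apply: rdot_eq0; apply/eqP; rewrite eq_le rdot_ge0 andbT.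
have := spectral_near KE Ksa (c := 0) (delta := 0) mzer (pvm_idem EK x mzer).
rewrite scale0r subr0 expr0n/= mul0r; apply => l ->.
by rewrite addr0 lexx.
Qed.

Lemma spectral_partsE x : K x = positive_part K EK x - negative_part K EK x.
Proof.
rewrite /positive_part /negative_part opprK -raddfD/= -pvm_setU//.
have mU : measurable (pos `|` neg) by exact: measurableU.
have -> : EK (pos `|` neg) x = x - EK zer x.
  rewrite -pvm_setC//; congr (EK _ x); apply/seteqP; split=> l; rewrite /pos /neg /zer /=.
    by rewrite !in_itv/= andbT => -[l0|l0] E0; rewrite E0 ltxx in l0.
  by move/eqP; rewrite !in_itv/= andbT neq_lt orbC => /orP.
by rewrite raddfB/= K_zer subr0.
Qed.

(** This is the absolute value [|K|]: the two parts have orthogonal ranges, so [Q x] and [K x] have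
    equal norms. *)
Let Q x := positive_part K EK x + negative_part K EK x.

Let Q_self_adjoint : self_adjoint Q.
Proof.
move=> u v; rewrite /Q dotpDl positive_part_self_adjoint negative_part_self_adjoint.
by rewrite [RHS]dotp_conj dotpDl rmorphD/= -!dotp_conj.
Qed.

Let parts_orth x : rdot (positive_part K EK x) (negative_part K EK x) = 0.
Proof.
rewrite /positive_part /negative_part (spectral_commute KE Ksa x mpos).
rewrite (spectral_commute KE Ksa x mneg) (formNr rdot_symmetric).
by rewrite pvm_orth// oppr0.
Qed.

Let Q_norm x : rdot (Q x) (Q x) = rdot (K x) (K x).
Proof.
rewrite spectral_partsE /Q (form_sqrD rdot_symmetric) (form_sqrB rdot_symmetric).
by rewrite parts_orth mulr0 addr0 subr0.
Qed.

(** The square root [P] provided by [trace_class] satisfies [|P x| = |K x| = |Q x|]. Monotonicity of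
    the square root then gives [Q <= P] as forms, and each part of [K] lies below [Q]. *)
Lemma spectral_parts_trace : trace_class K -> exists tau,
  trace_bounded (positive_part K EK) tau /\ trace_bounded (negative_part K EK) tau.
Proof.
move=> [K' [P [X [KK' [Pb Pp] PP Xb trP]]]].
have [tau tb] := trace_boundedP Pb Pp Xb trP; exists tau.
have [CP PC] := bounded_operatorP Pb.
have Ppsd := positive_operator_psd Pp.
have QP x : rdot (Q x) x <= rdot (P x) x.
  apply: (@sqrt_form_monotone _ _ P Q CP C) => //.
  - exact: Pp.1.
  - exact: Ppsd.2.
  - move=> y; rewrite /Q rdotDl.
    by rewrite addr_ge0 ?(psd_ge0 positive_part_psd) ?(psd_ge0 negative_part_psd).
  - split=> [|y]; first exact: KC.1.
    by rewrite Q_norm; exact: KC.2.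
  - move=> y; rewrite Q_norm (self_adjoint_rdot Pp.1) PP.
    by rewrite /rdot KK'.
split; apply: trace_bounded_le tb => x; apply: le_trans (QP x); rewrite /Q rdotDl.
  by rewrite lerDl (psd_ge0 negative_part_psd).
by rewrite lerDr (psd_ge0 positive_part_psd).
Qed.

End spectral_parts.

(** * Weighted forms over refining partitions *)

Section weighted_forms.
Context {R : realType} {H : hilbertType R}.
Implicit Types (k : H -> H -> R) (W V : nat -> H) (s : nat -> R).

(* The junk value [0^-1 = 0] is harmless: [W j = 0] whenever [s j = 0]. *)
Definition wform k (J : nat) s V W := \sum_(j < J) k (V j) (W j) / s j.

Definition dominated J s W :=
  forall j, (j < J)%N -> rdot (W j) (W j) <= s j.

Lemma wform_ge0 k J s V : psd_form k -> (forall j, (j < J)%N -> 0 <= s j) ->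
  0 <= wform k J s V V.
Proof.
by move=> kp s0; apply: sumr_ge0 => j _; rewrite divr_ge0 ?psd_ge0 ?s0.
Qed.

Lemma wform_sqrD k J s V W : symmetric_form k ->
  wform k J s (fun j => V j + W j) (fun j => V j + W j) =
  wform k J s V V + 2 * wform k J s V W + wform k J s W W.
Proof.
move=> ks; rewrite /wform mulr_sumr -!big_split/=; apply: eq_bigr => j _.
by rewrite form_sqrD//; ring.
Qed.

Lemma wform_sqrB k J s V W : symmetric_form k ->
  wform k J s (fun j => V j - W j) (fun j => V j - W j) =
  wform k J s V V - 2 * wform k J s V W + wform k J s W W.
Proof.
move=> ks; rewrite /wform mulr_sumr -sumrB -!big_split/=; apply: eq_bigr => j _.
by rewrite form_sqrB//; ring.
Qed.

Lemma wform_sqrB_le k J s U V W : psd_form k -> (forall j, (j < J)%N -> 0 <= s j) ->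
  wform k J s (fun j => U j - W j) (fun j => U j - W j) <=
  2 * wform k J s (fun j => U j - V j) (fun j => U j - V j) +
  2 * wform k J s (fun j => W j - V j) (fun j => W j - V j).
Proof.
move=> kp s0; rewrite /wform !mulr_sumr -big_split/=; apply: ler_sum => j _.
have -> : U j - W j = (U j - V j) - (W j - V j) by rewrite opprB addrA subrK.
rewrite !mulrA -mulrDl ler_wpM2r ?invr_ge0 ?s0//.
exact: psd_sqrB_le.
Qed.

(** After division by [sqrt (s j)] the vectors [W j] become an orthogonal family in the unit ball,
    and the weighted sum becomes a trace sum. *)
Lemma wform_trace (P : H -> H) tau J s W :
  symmetric_form (fun x y => rdot (P x) y) ->
  trace_bounded P tau -> dominated J s W ->
  (forall i j, (i < J)%N -> (j < J)%N -> i != j -> rdot (W i) (W j) = 0) ->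
  wform (fun x y => rdot (P x) y) J s W W <= tau.
Proof.
move=> Ps Pt dW oW.
have s0 j : (j < J)%N -> 0 <= s j.
  by move=> jJ; apply: le_trans (dW j jJ); exact: rdot_ge0.
pose f j := (Num.sqrt (s j))^-1%:C *: W j.
have fE (k : H -> H -> R) (ks : symmetric_form k) j : (j < J)%N ->
    k (f j) (f j) = k (W j) (W j) / s j.
  move=> jJ; rewrite /f (formZl ks) (formZr ks) mulrA -expr2 exprVn.
  by rewrite sqr_sqrtr ?s0// mulrC.
have -> : wform (fun x y => rdot (P x) y) J s W W =
    \sum_(j < J) rdot (P (f j)) (f j).
  by apply: eq_bigr => j _; rewrite (fE _ Ps).
apply: Pt => [i j iJ jJ ij|j jJ].
  by rewrite /f rdotZl (formZr rdot_symmetric) oW// !mulr0.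
rewrite (fE _ rdot_symmetric)//.
have := s0 j jJ; rewrite le_eqVlt => /orP[/eqP <-|sj]; first by rewrite invr0 mulr0.
by rewrite ler_pdivrMr// mul1r dW.
Qed.

Lemma big_double (F : nat -> R) J :
  \sum_(j < J.*2) F j = \sum_(j < J) (F j.*2 + F j.*2.+1).
Proof.
elim: J => [|J IH]; first by rewrite !big_ord0.
by rewrite doubleS !big_ord_recr/= IH addrA.
Qed.

(** Joint convexity of [(x, p) |-> k x x / p]: for positive weights the right side minus the left is
    the value of [k] at [q x - p y], divided by [p q (p + q)]. *)
Lemma form_weighted_refine k (x y : H) (p q : R) : psd_form k -> 0 <= p -> 0 <= q ->
  (p = 0 -> x = 0) -> (q = 0 -> y = 0) ->
  k (x + y) (x + y) / (p + q) <= k x x / p + k y y / q.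
Proof.
move=> kp + + px qy; have ks := kp.1.
rewrite le_eqVlt => /orP[/eqP p0 _|p0].
  by rewrite (px (esym p0)) -p0 add0r !add0r (form0l ks) mul0r add0r.
rewrite le_eqVlt => /orP[/eqP q0|q0].
  by rewrite (qy (esym q0)) -q0 !addr0 (form0l ks) mul0r addr0.
have h := psd_ge0 kp (q%:C *: x - p%:C *: y).
rewrite (form_sqrB ks) !(formZl ks) !(formZr ks) in h.
rewrite (form_sqrD ks) ler_pdivrMr ?addr_gt0//.
have -> : (k x x / p + k y y / q) * (p + q) = (k x x * q + k y y * p) * (p + q) / (p * q).
  by field; rewrite !gt_eqF.
by rewrite ler_pdivlMr ?mulr_gt0//; nra.
Qed.

End weighted_forms.

(** * Monotonicity in the level and comparison of two profiles *)

Section refinements.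
Context {R : realType} {H : hilbertType R}.
Variables (L : nat) (s : nat -> nat -> R).
Implicit Types (k : H -> H -> R) (V W : nat -> nat -> H).

Definition cells n := (L * 2 ^ n)%N.

Hypothesis s_ge0 : forall n j, 0 <= s n j.
Hypothesis s_refine : forall n j, s n j = s n.+1 j.*2 + s n.+1 j.*2.+1.

Definition adapted W :=
  (forall n j, W n j = W n.+1 j.*2 + W n.+1 j.*2.+1) /\
  (forall n j, s n j = 0 -> W n j = 0).

Definition qform k n V W := wform k (cells n) (s n) (V n) (W n).

(** [k1] is the dominant form, [c] a lower bound for it, and [n0] a level beyond which neither form
    grows by more than a percent of [c]. The template [D] is to be shared by all members of a class,
    so that any two of them are compared through it. *)
Definition well_profiled k1 k2 (c : R) (n0 : nat) (D : nat -> H) W :=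
  [/\ adapted W, c <= qform k1 n0 W W,
      forall n, (n0 <= n)%N ->
        [/\ qform k1 n W W <= qform k1 n0 W W + c / 100,
            qform k2 n W W <= qform k2 n0 W W + c / 100
          & qform k2 n W W <= qform k1 n0 W W + c / 100]
    & qform k1 n0 (fun n j => W n j - D j) (fun n j => W n j - D j) <= c / 400 /\
      qform k2 n0 (fun n j => W n j - D j) (fun n j => W n j - D j) <= c / 400].

Lemma adaptedD V W : adapted V -> adapted W -> adapted (fun n j => V n j + W n j).
Proof.
move=> [V1 V0] [W1 W0]; split=> [n j|n j s0]; first by rewrite V1 W1 addrACA.
by rewrite V0// W0// addr0.
Qed.

Lemma qform_refine k W n m : psd_form k -> adapted W -> (n <= m)%N ->
  qform k n W W <= qform k m W W.
Proof.
move=> kp [W1 W0] /subnK <-; elim: (m - n)%N => [|d IH]; first by rewrite add0n.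
apply: le_trans IH _; rewrite addSn; move: (d + n)%N => i.
rewrite /qform /wform [in leRHS]/cells expnS mulnCA mul2n.
rewrite (big_double (fun j => k (W i.+1 j) (W i.+1 j) / s i.+1 j)).
apply: ler_sum => j _; rewrite W1 s_refine.
by apply: form_weighted_refine => //; exact: W0.
Qed.

(* Apply monotonicity to [V + W] and the parallelogram identity. *)
Lemma qform_refineB k V W n m : psd_form k -> adapted V -> adapted W -> (n <= m)%N ->
  qform k m (fun i j => V i j - W i j) (fun i j => V i j - W i j) <=
    qform k n (fun i j => V i j - W i j) (fun i j => V i j - W i j) +
    2 * (qform k m V V - qform k n V V) + 2 * (qform k m W W - qform k n W W).
Proof.
move=> kp aV aW nm; have := qform_refine kp (adaptedD aV aW) nm.
by rewrite /qform !(wform_sqrB _ _ _ _ kp.1) !(wform_sqrD _ _ _ _ kp.1); lra.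
Qed.

(* The level-[n0] profiles of [V] and [W] are close and nearly exhaust their
   forms, so at all later levels [qform k1 V W] stays close to [qform k1 V V]
   and, up to a few percent, dominates [qform k2 V W]. *)
Lemma well_profiled_cone k1 k2 (c a b : R) n0 (D : nat -> H) V W :
  psd_form k1 -> psd_form k2 -> 0 < c ->
  well_profiled k1 k2 c n0 D V -> well_profiled k1 k2 c n0 D W ->
  (forall eps, 0 < eps -> exists2 n, (n0 <= n)%N &
     `|a * qform k1 n V W + b * qform k2 n V W| <= eps) ->
  `|a| <= 2 * `|b|.
Proof.
move=> k1p k2p c0 [aV V1 Vn [VD1 VD2]] [aW W1 Wn [WD1 WD2]] hn.
pose q := qform; rewrite -/q in V1 Vn VD1 VD2 W1 Wn WD1 WD2 hn.
have s0 n j : (j < cells n)%N -> 0 <= s n j by [].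
(* Passing through [D] costs [4 * (c / 400) = c / 100] at level [n0]; refining costs twice [c / 100]
   for each of [V] and [W]. Together this is five hundredths of [c]. *)
have close k : psd_form k ->
  q k n0 (fun n j => V n j - D j) (fun n j => V n j - D j) <= c / 400 ->
  q k n0 (fun n j => W n j - D j) (fun n j => W n j - D j) <= c / 400 ->
  (forall n, (n0 <= n)%N -> q k n V V <= q k n0 V V + c / 100) ->
  (forall n, (n0 <= n)%N -> q k n W W <= q k n0 W W + c / 100) ->
  forall n, (n0 <= n)%N ->
    q k n V V + q k n W W - 2 * q k n V W <= 5 * (c / 100).
  move=> kp VD WD VV WW n nn.
  have := qform_refineB kp aV aW nn; rewrite -/q; have := VV _ nn; have := WW _ nn.
  have := wform_sqrB_le (V n0) D (W n0) kp (s0 n0).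
  move: VD WD; rewrite /q /qform (wform_sqrB _ _ _ _ kp.1) => VD WD.
  by rewrite (wform_sqrB _ _ (V n) _ kp.1); lra.
apply/ler_addgt0Pr => eps eps0.
have [n nn] := hn (eps * c / 2) ltac:(by rewrite divr_gt0// mulr_gt0).
have := close k1 k1p VD1 WD1 (fun n h => let: And3 x _ _ := Vn n h in x)
  (fun n h => let: And3 x _ _ := Wn n h in x) n nn.
have := close k2 k2p VD2 WD2 (fun n h => let: And3 _ x _ := Vn n h in x)
  (fun n h => let: And3 _ x _ := Wn n h in x) n nn.
have [V2 _ V3] := Vn n nn; have [W2 _ W3] := Wn n nn.
have V4 := qform_refine k1p aV nn; have W4 := qform_refine k1p aW nn.
have V5 := wform_ge0 (V n) k2p (s0 n); have W5 := wform_ge0 (W n) k2p (s0 n).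
have q2 : 2 * q k2 n V W <= q k2 n V V + q k2 n W W.
  have := wform_ge0 (fun j => V n j - W n j) k2p (s0 n).
  rewrite (wform_sqrB _ _ _ _ k2p.1).
  by rewrite -/(qform k2 n V V) -/(qform k2 n V W) -/(qform k2 n W W) -/q; lra.
rewrite -/(qform k2 n V V) in V5; rewrite -/(qform k2 n W W) in W5.
rewrite -/q in V4 W4 V5 W5.
move: V1 W1 V2 W2 V3 W3 V4 W4 V5 W5 q2.
set p1 := q k1 n0 V V; set p2 := q k1 n0 W W; set x1 := q k1 n V V.
set x2 := q k1 n W W; set y1 := q k2 n V V; set y2 := q k2 n W W.
set x := q k1 n V W; set y := q k2 n V W.
move=> V1 W1 V2 W2 V3 W3 V4 W4 V5 W5 q2 hy hx habs.
pose p := (p1 + p2) / 2.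
have pc : c <= p by rewrite /p; lra.
(* From [2 x >= x1 + x2 - 5 c / 100] and [c <= p]; the bound on [y] uses that the second form is at
   most the first plus a percent. Since 101/97 is below 2, the slope 2 leaves room for [eps]. *)
have xp : 97 / 100 * p <= x by rewrite /p; lra.
have yp : `|y| <= 101 / 100 * p by rewrite ler_norml /p; apply/andP; split; lra.
have ax : `|a| * x <= eps * c / 2 + `|b| * `|y|.
  have x0 : 0 <= x by lra.
  rewrite -[X in _ * X](ger0_norm x0) -!normrM.
  have := ler_normB (a * x + b * y) (b * y); rewrite addrK => h.
  by apply: le_trans h _; rewrite lerD2r.
have a0 := normr_ge0 a; have b0 := normr_ge0 b.
have p0 : 0 < p by lra.
rewrite -(ler_pM2r p0).
have h1 : `|a| * (97 / 100 * p) <= `|a| * x by exact: ler_wpM2l.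
have h2 : `|b| * `|y| <= `|b| * (101 / 100 * p) by exact: ler_wpM2l.
have h3 : eps * c <= eps * p by rewrite ler_pM2l.
have h4 : 0 <= `|b| * p by rewrite mulr_ge0// ltW.
have h5 : 0 <= `|a| * p by rewrite mulr_ge0// ltW.
have h6 : 0 <= eps * p by rewrite mulr_ge0// ltW.
rewrite mulrDl; move: h1 h2 h3 h4 h5 h6; rewrite -mulrA.
rewrite (mulrCA `|a|) (mulrCA `|b|); lra.
Qed.

End refinements.

(** * Dyadic cells *)

Lemma small_dyadic (R : realType) (e : R) : 0 < e ->
  exists n, forall m, (n <= m)%N -> (2 ^+ m)^-1 < e.
Proof.
move=> e0; have [n _ hn] := near_infty_natSinv_expn_lt (PosNum e0).
by exists n => m /hn /=; rewrite ?div1r.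
Qed.

Section dyadic_cells.
Context {R : realType}.
Variable N : nat.
Implicit Types (n m j i : nat) (x : measurableTypeR R) (C U Z : set (measurableTypeR R)).

(** Anchoring at [- N] makes indices natural numbers: the first [2 N 2^n] cells tile the window, and
    the halves of cell [j] are cells [2 j] and [2 j + 1] of the next level. *)
Definition cell n j : set (measurableTypeR R) :=
  `[j%:R / 2 ^+ n - N%:R, j.+1%:R / 2 ^+ n - N%:R[%classic.

Definition window : set (measurableTypeR R) := `[- N%:R, N%:R[%classic.

Lemma cellP n j (x : R) :
  cell n j x <-> j%:R <= (x + N%:R) * 2 ^+ n < j.+1%:R.
Proof.
have p0 : 0 < 2 ^+ n :> R by rewrite exprn_gt0.
by rewrite /cell/= in_itv/= lerBlDr ltrBrDr ler_pdivrMr// ltr_pdivlMr.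
Qed.

Lemma windowP (x : R) : window x <-> - N%:R <= x < N%:R.
Proof. by rewrite /window/= in_itv. Qed.

Lemma measurable_cell n j : measurable (cell n j).
Proof. exact: measurable_itv. Qed.

Lemma measurable_window : measurable window.
Proof. exact: measurable_itv. Qed.

Lemma cell_inj n i j (x : R) : cell n i x -> cell n j x -> i = j.
Proof.
move=> /cellP/andP[i1 i2] /cellP/andP[j1 j2]; apply/eqP; rewrite eqn_leq.
have := le_lt_trans i1 j2; have := le_lt_trans j1 i2.
by rewrite !ltr_nat !ltnS => -> ->.
Qed.

Lemma cell_disjoint n i j : i != j -> cell n i `&` cell n j = set0.
Proof.
move=> ij; rewrite -subset0 => x [xi xj]; move/eqP: ij; apply.
exact: cell_inj xi xj.
Qed.

Lemma cell_refine n j : cell n j = cell n.+1 j.*2 `|` cell n.+1 j.*2.+1.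
Proof.
apply/seteqP; split=> [x /cellP/andP[x1 x2]|x].
  have [x3|x3] := ltP ((x + N%:R) * 2 ^+ n.+1) (j.*2.+1)%:R; [left|right].
    apply/cellP; rewrite x3 andbT exprSr mulrA -muln2 natrM.
    by rewrite ler_pM2r.
  apply/cellP; rewrite x3/= exprSr mulrA -doubleS -muln2 natrM.
  by rewrite ltr_pM2r.
case=> /cellP/andP[]; rewrite exprSr mulrA => x1 x2; apply/cellP; apply/andP.
  split; first by move: x1; rewrite -muln2 natrM ler_pM2r.
  have : (x + N%:R) * 2 ^+ n * 2 < (j.*2.+2)%:R.
    by apply: lt_trans x2 _; rewrite ltr_nat.
  by rewrite -doubleS -muln2 natrM ltr_pM2r.
split.
  have : (j.*2)%:R <= (x + N%:R) * 2 ^+ n * 2.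
    by apply: le_trans x1; rewrite ler_nat.
  by rewrite -muln2 natrM ler_pM2r.
by move: x2; rewrite -doubleS -muln2 natrM ltr_pM2r.
Qed.

Lemma window_cell n (x : R) : window x ->
  exists2 j, (j < cells (2 * N) n)%N & cell n j x.
Proof.
move=> /windowP/andP[x1 x2]; pose y := (x + N%:R) * 2 ^+ n.
have p0 : 0 < 2 ^+ n :> R by rewrite exprn_gt0.
have y0 : 0 <= y by rewrite mulr_ge0 ?(ltW p0)//; lra.
have /andP[h1 h2] := Num.Theory.truncn_itv y0.
exists (Num.trunc y); last by apply/cellP; rewrite h1 h2.
rewrite -(ltr_nat R) (le_lt_trans h1)// /cells natrM natrX /y ltr_pM2r//.
by rewrite natrM; lra.
Qed.

Lemma cell_range n j l : cell n j l -> let c := j%:R / 2 ^+ n - N%:R in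
  c <= l <= c + (2 ^+ n)^-1.
Proof.
rewrite /cell/= in_itv/= => /andP[-> /ltW]; rewrite -(natr1 j) mulrDl mul1r.
by rewrite addrAC.
Qed.

Lemma lebesgue_cell n j : lebesgue_measure (cell n j) = ((2 ^+ n)^-1 : R)%:E.
Proof.
have p0 : 0 < (2 ^+ n)^-1 :> R by rewrite invr_gt0 exprn_gt0.
rewrite lebesgue_measure_itv/= lte_fin -(natr1 j) mulrDl mul1r ifT; last by lra.
by rewrite -EFinD; congr EFin; lra.
Qed.

Definition meets C n : pred nat := fun j => `[< cell n j `&` C !=set0 >].

(** A dyadic form of vanishing lower Minkowski content. It is stronger than being a null set, since
    all covering cells have the same length; a dense countable subset of a nonempty window fails
    it. *)
Definition thin C := forall (e : R) n0, 0 < e -> exists2 n, (n0 <= n)%N &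
  \sum_(j < cells (2 * N) n | meets C n j) (2 ^+ n)^-1 <= e.

Definition inner_cells U n : set (measurableTypeR R) :=
  \bigcup_(j in [set j | cell n j `<=` U]) (cell n j).

Lemma measurable_inner_cells U n : measurable (inner_cells U n).
Proof. by apply: bigcup_measurable => j _; exact: measurable_cell. Qed.

Lemma inner_cells_sub U n : inner_cells U n `<=` U.
Proof. by move=> x [j jU] /jU. Qed.

Lemma inner_cells_mono U n m : (n <= m)%N -> inner_cells U n `<=` inner_cells U m.
Proof.
move=> /subnK <-; elim: (m - n)%N => [|d IH]; first by rewrite add0n.
apply: subset_trans IH _; rewrite addSn; move: (d + n)%N => i x [j /= jU].
rewrite cell_refine in jU *.
by case=> xj; [exists j.*2|exists j.*2.+1] => // y yj; apply: jU; [left|right].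
Qed.

Lemma inner_cells_exhaust U x : open (U : set R) -> U x -> window x ->
  exists n, inner_cells U n x.
Proof.
move=> oU Ux wx; have /nbhs_ballP[r /= r0 rU] : nbhs (x : R) (U : set R).
  exact: open_nbhs_nbhs.
have [n hn] : exists n, (2 ^+ n)^-1 < r :> R.
  have [n hn] := small_dyadic r0; exists n.
  by have := hn n (leqnn n).
have [j _ xj] := window_cell n wx; exists n, j => //= y yj.
apply: rU; rewrite /ball/=.
have /= /andP[x1 x2] := cell_range xj; have /= /andP[y1 y2] := cell_range yj.
by apply: le_lt_trans hn; rewrite ler_norml; apply/andP; split; lra.
Qed.

(** Two cells of one level that meet are equal, so a cell meeting [C] is itself one of the inner
    cells. *)
Lemma meets_inner_cells C U n : C `<=` inner_cells U n ->
  ((\sum_(j < cells (2 * N) n | meets C n j) (2 ^+ n)^-1 : R)%:E <=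
   lebesgue_measure (inner_cells U n))%E.
Proof.
move=> CU; rewrite -sumEFin.
under eq_bigr => j _ do rewrite -(lebesgue_cell n j).
rewrite -measure_bigsetU_ord_cond; last 2 first.
- by move=> j _; exact: measurable_cell.
- move=> i j _ _ [x [xi xj]]; apply/val_inj; exact: cell_inj xi xj.
apply: le_measure; rewrite ?inE.
- by apply: bigsetU_measurable => j _; exact: measurable_cell.
- exact: measurable_inner_cells.
apply: (big_ind (fun A => A `<=` inner_cells U n)) => //.
  by move=> A B hA hB; rewrite subUset.
move=> j /asboolP[x [xj /CU [i /= iU xi]]] y yj.
by rewrite -(cell_inj xi xj) in yj; exists i.
Qed.

(** Enclose [Z] in open sets [U i] of length at most [h i] and replace each by its inner cells at a
    level [p i] so fine that [sigma] loses at most [h i]. By Borel-Cantelli, [sigma]-almost every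
    point of [Z] in the window lies in all but finitely many of these unions; [C m] collects the
    points lying in all of them from index [m] on. *)
Lemma thin_cover (sigma : {finite_measure set (measurableTypeR R) -> \bar R}) Z :
  measurable Z -> lebesgue_measure Z = 0%E -> exists C : nat -> set (measurableTypeR R),
    [/\ forall m, measurable (C m), forall m, C m `<=` window, forall m, thin (C m)
      & sigma ((Z `&` window) `\` \bigcup_m C m) = 0%E].
Proof.
move=> mZ Z0.
pose h i : R := 1 / (2 ^ i.+1)%:R.
have h0 i : 0 < h i by rewrite divr_gt0// ltr0n expn_gt0.
have /choice[U hU] i : exists U : set (measurableTypeR R),
    [/\ open (U : set R), Z `<=` U, measurable U & (lebesgue_measure U <= (h i)%:E)%E].
  have Zoo : (lebesgue_measure Z < +oo)%E by rewrite Z0 ltry.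
  have [U [oU ZU UZ]] := lebesgue_regularity_outer mZ Zoo (h0 i).
  have mU : measurable (U : set (measurableTypeR R)) by exact: open_measurable.
  exists U; split=> //; rewrite -(setDUK ZU).
  apply: le_trans (measureU2 _ _ _) _ => //; first exact: measurableD.
  by rewrite [X in (X + _)%E]Z0 add0e ltW.
pose F i n := (Z `&` window) `\` inner_cells (U i) n.
have mF i n : measurable (F i n).
  apply: measurableD; last exact: measurable_inner_cells.
  by apply: measurableI => //; exact: measurable_window.
have /choice[p hp] i : exists n, (sigma (F i n) <= (h i)%:E)%E.
  have F0 : \bigcap_n F i n = set0.
    have [oU ZU _ _] := hU i.
    rewrite -subset0 => x hx; have [[Zx wx] _] := hx 0%N I.
    by have [n xn] := inner_cells_exhaust oU (ZU _ Zx) wx; have [_] := hx n I.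
  have : sigma \o F i @ \oo --> sigma (\bigcap_n F i n).
    apply: nonincreasing_cvg_mu => //.
    - by rewrite -ge0_fin_numE// fin_num_measure.
    - by rewrite F0.
    - move=> n m nm; apply/subsetPset; apply: setDS; exact: inner_cells_mono.
  rewrite F0 measure0 => /fine_cvgP[fF] /cvgrPdist_lt/(_ _ (h0 i)) cF.
  near \oo => n; exists n.
  have fn : sigma (F i n) \is a fin_num by near: n.
  rewrite -(fineK fn) lee_fin.
  have : `|0 - fine (sigma (F i n))| < h i by near: n.
  by rewrite sub0r normrN => /ltW; apply: le_trans; exact: ler_norm.
pose C m := (Z `&` window) `&` \bigcap_(i in [set i | (m <= i)%N]) inner_cells (U i) (p i).
exists C; split.
- move=> m; apply: measurableI.
    by apply: measurableI => //; exact: measurable_window.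
  apply: bigcap_measurable => [|i _]; first by exists m => /=.
  exact: measurable_inner_cells.
- by move=> m x [[]].
- move=> m e n0 e0.
  have [n1 hn1] := small_dyadic e0.
  (* [i >= m] puts [C m] inside the [i]-th union, and [i >= n1] makes [h i < e]. Raising the level
     to at least [n0] only enlarges the inner cells within [U i]. *)
  pose i := maxn m n1; exists (maxn n0 (p i)); first exact: leq_maxl.
  rewrite -lee_fin (@le_trans _ _ (lebesgue_measure (inner_cells (U i) (maxn n0 (p i)))))//.
    apply: meets_inner_cells => x [_ /(_ i)]; rewrite /= leq_maxl => /(_ isT).
    by apply: inner_cells_mono; exact: leq_maxr.
  have [_ _ mU Ui] := hU i.
  apply: (@le_trans _ _ (lebesgue_measure (U i))).
    by apply: le_measure; rewrite ?inE//; [exact: measurable_inner_cells|exact: inner_cells_sub].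
  apply: le_trans Ui _; rewrite lee_fin ltW// /h div1r natrX.
  by apply: hn1; rewrite leqW// leq_maxr.
- have := @lim_sup_set_cvg0 _ _ _ sigma _ (fun i => mF i (p i)).
  have -> : lim_sup_set (fun i => F i (p i)) = (Z `&` window) `\` \bigcup_m C m.
    apply/seteqP; split=> x.
      move=> hx; have [i _ [Zx _]] := hx 0%N I; split=> // -[m _ [_ hC]].
      by have [j /= mj [_]] := hx m I; apply; exact: hC.
    move=> [Zx nC] m _; apply: contrapT => hm; apply: nC; exists m => //; split=> // i /= mi.
    by apply: contrapT => hi; apply: hm; exists i.
  apply; apply: (@le_lt_trans _ _ (\sum_(0 <= i <oo) (h i)%:E)%E).
    by apply: lee_nneseries => i _ //; exact: hp.
  by apply: le_lt_trans (epsilon_trick0 xpredT ler01) _; rewrite ltry.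
Unshelve. all: by end_near. Qed.

End dyadic_cells.

(** * Vectors with spectral measure dominated by sigma *)

Section dominated_parts.
Context d (T : measurableType d) (R : realType).
Local Open Scope ereal_scope.

Lemma null_bigcup (mu : {measure set T -> \bar R}) (F : (set T)^nat) :
  (forall i, measurable (F i)) -> (forall i, mu (F i) = 0) ->
  mu (\bigcup_i F i) = 0.
Proof.
move=> mF F0; apply/(@negligibleP _ _ _ mu); first exact: bigcup_measurable.
by apply: negligible_bigcup => i; apply/(@negligibleP _ _ _ mu _ (mF i)); exact: F0.
Qed.

(* On the negative set of a Hahn decomposition of [nu - M sigma] one has
   [nu <= M sigma]; the intersection over [M] of the positive sets is
   [sigma]-null. *)
Lemma dominated_part (nu sigma : {finite_measure set T -> \bar R})
    (C : nat -> nat -> set T) :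
  (forall N i, measurable (C N i)) ->
  sigma (~` \bigcup_N \bigcup_i C N i) = 0 ->
  (forall B, measurable B -> nu B = 0 -> sigma (~` B) <> 0) ->
  exists N i (M : nat) D, [/\ measurable D, D `<=` C N i, nu D <> 0
    & forall B, measurable B -> B `<=` D -> nu B <= M%:R%:E * sigma B].
Proof.
move=> mC C0 ns; apply: contrapT => hn.
pose l M := cadd (charge_of_finite_measure nu)
                 (cscale (- M%:R) (charge_of_finite_measure sigma)).
have /choice[P hP] M : exists P, exists Q, hahn_decomposition (l M) P Q.
  by have [P [Q PQ]] := Hahn_decomposition (l M); exists P, Q.
have {hP} /choice[Q hPQ] := hP.
have mP M : measurable (P M) by have [[]] := hPQ M.
have mQ M : measurable (Q M) by have [_ []] := hPQ M.
have mU : measurable (\bigcup_N \bigcup_i C N i).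
  by apply: bigcup_measurable => N _; exact: bigcup_measurable.
have mUQ : measurable (\bigcup_M Q M) by exact: bigcup_measurable.
have Q0 M N i : nu (Q M `&` C N i) = 0.
  apply: contrapT => h; apply: hn; exists N, i, M, (Q M `&` C N i); split=> //.
    exact: measurableI.
  move=> B mB BQ; have [_ [_ hQ] _ _] := hPQ M.
  have : nu B + (- M%:R)%:E * sigma B <= 0.
    exact: hQ B mB (subset_trans BQ (@subIsetl _ _ _)).
  rewrite -(fineK (fin_num_measure nu _ mB)) -(fineK (fin_num_measure sigma _ mB)).
  by rewrite -!EFinM -EFinD !lee_fin; lra.
pose B := (\bigcup_M Q M) `&` (\bigcup_N \bigcup_i C N i).
have mB : measurable B by exact: measurableI.
apply: (ns B mB).
  have -> : B = \bigcup_M \bigcup_N \bigcup_i (Q M `&` C N i).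
    apply/seteqP; split=> x.
      by move=> [[M _ xM] [N _ [i _ xi]]]; exists M => //; exists N => //; exists i.
    by move=> [M _ [N _ [i _ [xM xi]]]]; split; [exists M|exists N => //; exists i].
  have mQC M N i : measurable (Q M `&` C N i) by exact: measurableI.
  have mQC1 M N : measurable (\bigcup_i (Q M `&` C N i)) by exact: bigcup_measurable.
  apply: null_bigcup => M; first by apply: bigcup_measurable => k _; exact: mQC1.
  apply: null_bigcup => [N|N]; first exact: mQC1.
  by apply: null_bigcup => i; [exact: mQC|exact: Q0].
apply/eqP; rewrite eq_le measure_ge0 andbT setCI.
apply: le_trans (measureU2 _ _ _) _; try exact: measurableC.
rewrite [X in _ + X]C0 adde0.
have mA : measurable (~` \bigcup_M Q M) by exact: measurableC.
have AP M : ~` (\bigcup_M Q M) `<=` P M.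
  move=> x nx; have [_ _ PQT _] := hPQ M.
  have : (P M `|` Q M) x by rewrite PQT.
  by case=> // Qx; case: nx; exists M.
have h M : (M%:R * fine (sigma (~` \bigcup_M Q M)) <= fine (nu (~` \bigcup_M Q M)))%R.
  have [[_ hPM] _ _ _] := hPQ M; have : 0 <= nu (~` \bigcup_M Q M) + (- M%:R)%:E * sigma (~` \bigcup_M Q M).
    exact: hPM _ mA (AP M).
  rewrite -(fineK (fin_num_measure nu _ mA)) -(fineK (fin_num_measure sigma _ mA)).
  by rewrite -!EFinM -EFinD !lee_fin /=; lra.
rewrite -(fineK (fin_num_measure sigma _ mA)) lee_fin leNgt; apply/negP => s0.
(* An integer [M] exceeding the ratio of the two masses violates [M sigma <= nu] on the common
   positive set. *)
have := h (Num.trunc (fine (nu (~` \bigcup_M Q M)) /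
  fine (sigma (~` \bigcup_M Q M)))%R).+1.
apply/negP; rewrite -ltNge -ltr_pdivrMr//.
set q := (_ / _)%R; have q0 : (0 <= q)%R by rewrite divr_ge0 ?fine_ge0.
by have /andP[] := Num.Theory.truncn_itv q0.
Qed.

End dominated_parts.

(** * Cutting a vector along the dyadic cells *)

Section cell_vectors.
Context {R : realType} {H : hilbertType R}.
Variables (N : nat) (sigma : {finite_measure set (measurableTypeR R) -> \bar R}).
Implicit Types (E : pvm H) (v : H) (C : set (measurableTypeR R)).

Definition cell_mass n j : R := fine (sigma (cell N n j)).

Definition cell_vec E v n j : H := E (cell N n j) v.

Definition subordinate E v := forall B, measurable B ->
  (scalar_measure E v B <= sigma B)%E.

Let mcell n j : measurable (cell N n j : set (measurableTypeR R)).
Proof. exact: measurable_cell. Qed.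

Lemma cell_mass_ge0 n j : 0 <= cell_mass n j.
Proof. exact: fine_ge0. Qed.

Lemma cell_mass_refine n j :
  cell_mass n j = cell_mass n.+1 j.*2 + cell_mass n.+1 j.*2.+1.
Proof.
rewrite /cell_mass cell_refine measureU//.
  by rewrite fineD// fin_num_measure.
by rewrite cell_disjoint// neq_ltn leqnn.
Qed.

Lemma cell_vec_refine E v n j :
  cell_vec E v n j = cell_vec E v n.+1 j.*2 + cell_vec E v n.+1 j.*2.+1.
Proof.
rewrite /cell_vec cell_refine pvm_setU//.
by rewrite cell_disjoint// neq_ltn leqnn.
Qed.

Lemma cell_vec_le E v n j : subordinate E v ->
  rdot (cell_vec E v n j) (cell_vec E v n j) <= cell_mass n j.
Proof.
move=> Ev; rewrite -lee_fin /cell_mass fineK ?fin_num_measure//.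
by rewrite /cell_vec -scalar_measure_sqr// Ev.
Qed.

Lemma cell_vec_adapted E v : subordinate E v -> adapted cell_mass (cell_vec E v).
Proof.
move=> Ev; split=> [n j|n j s0]; first exact: cell_vec_refine.
by apply: rdot_eq0; apply/eqP; rewrite eq_le rdot_ge0 -{1}s0 cell_vec_le.
Qed.

Lemma cell_vec_orth E v n i j : i != j ->
  rdot (cell_vec E v n i) (cell_vec E v n j) = 0.
Proof. by move=> ij; rewrite pvm_orth// cell_disjoint. Qed.

Lemma cell_vec_trace E v n (P : H -> H) tau : subordinate E v ->
  symmetric_form (fun x y => rdot (P x) y) -> trace_bounded P tau ->
  wform (fun x y => rdot (P x) y) (cells (2 * N) n) (cell_mass n)
    (cell_vec E v n) (cell_vec E v n) <= tau.
Proof.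
move=> Ev Ps Pt; apply: wform_trace => // [j _|i j _ _ ij].
  exact: cell_vec_le.
exact: cell_vec_orth.
Qed.

(* [(T - c) w_j] and [(T' - c) w'_j] are small for [c] in the [j]-th cell, so
   the commutator-like sum only sees the lengths of the cells meeting [C]. *)
Lemma commutator_bound (T T' : H -> H) E E' v v' C n :
  spectral_pvm T E -> self_adjoint T -> spectral_pvm T' E' -> self_adjoint T' ->
  subordinate E v -> subordinate E' v' -> measurable C -> E C v = v ->
  `|\sum_(j < cells (2 * N) n)
     (rdot (T (cell_vec E v n j)) (cell_vec E' v' n j) -
      rdot (T' (cell_vec E v n j)) (cell_vec E' v' n j)) / cell_mass n j| <=
  2 * \sum_(j < cells (2 * N) n | meets N C n j) (2 ^+ n)^-1.
Proof.
move=> TE Tsa TE' Tsa' Ev Ev' mC Cv.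
set w := cell_vec E v n; set w' := cell_vec E' v' n.
apply: le_trans (ler_norm_sum _ _ _) _; rewrite mulr_sumr [leRHS]big_mkcond/=.
apply: ler_sum => j _; have p0 : 0 < 2 ^+ n :> R by rewrite exprn_gt0.
case: ifPn => [_|/asboolP nC]; last first.
  have -> : w j = 0.
    rewrite /w /cell_vec -Cv -pvm_setI//.
    suff -> : cell N n j `&` C = set0 by rewrite pvm_set0.
    by apply: contrapT => /eqP/set0P.
  rewrite !self_adjoint0// (form0l rdot_symmetric) subrr mul0r normr0//.
have ww := cell_vec_le n j Ev; have ww' := cell_vec_le n j Ev'.
rewrite -/(w j) in ww; rewrite -/(w' j) in ww'.
pose s := cell_mass n j; rewrite -/s in ww ww' *.
have s0 : 0 <= s := cell_mass_ge0 n j.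
have [->|sn] := eqVneq s 0; first by rewrite invr0 mulr0 normr0 mulr_ge0// invr_ge0 ltW.
have sp : 0 < s by rewrite lt_def sn.
rewrite normrM (ger0_norm (x := s^-1)) ?invr_ge0// ler_pdivrMr//.
pose c : R := j%:R / 2 ^+ n - N%:R.
have near (S : H -> H) F u : spectral_pvm S F -> self_adjoint S ->
    subordinate F u -> forall y, rdot y y <= s ->
    `|rdot (S (cell_vec F u n j) - c%:C *: cell_vec F u n j) y| <= (2 ^+ n)^-1 * s.
  move=> SF Ssa Fu y ys.
  have cs : 0 <= (2 ^+ n)^-1 * s by rewrite mulr_ge0// invr_ge0 ltW.
  rewrite -(@ler_pXn2r _ 2)// ?nnegrE// real_normK ?num_real//.
  apply: le_trans (psd_CauchySchwarz rdot_psd _ _) _.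
  rewrite exprMn expr2 -expr2 (expr2 s) mulrA.
  apply: ler_pM => //; try exact: rdot_ge0.
  have := @spectral_near _ _ F S SF Ssa (cell N n j) (cell_vec F u n j) c (2 ^+ n)^-1 (mcell n j)
    (pvm_idem _ _ (mcell n j)) (fun l => @cell_range _ N n j l).
  move/le_trans; apply; rewrite ler_wpM2l ?sqr_ge0//.
  exact: cell_vec_le.
(* The same [c] is subtracted from both operators and cancels; moving [T'] onto [w' j] leaves two
   residuals, each in the range of its own spectral projection. *)
have -> : rdot (T (w j)) (w' j) - rdot (T' (w j)) (w' j) =
    rdot (T (w j) - c%:C *: w j) (w' j) - rdot (T' (w' j) - c%:C *: w' j) (w j).
  rewrite !(formBl rdot_symmetric) !rdotZl (self_adjoint_rdot Tsa').
  by rewrite (rdotC (w' j) (w j)) (rdotC (T' (w' j))); ring.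
apply: le_trans (ler_normB _ _) _; rewrite -mulrA mulr2n mulrDl !mul1r.
by apply: lerD; apply: near.
Qed.

End cell_vectors.

(** * Cyclicity *)

Section cyclicity.
Context {R : realType} {H : hilbertType R}.
Variables (A K : {linear H -> H}) (T : H -> H) (E : pvm H) (N : nat) (v : H).
Hypotheses (Asa : self_adjoint A) (Ksa : self_adjoint K).
Hypotheses (TE : spectral_pvm T E) (Tsa : self_adjoint T).
Hypothesis TA : forall u, K u = 0 -> T u = A u.
Hypothesis K_cyclic : cyclic_set A (range K).
Hypothesis vN : E (window N) v = v.
Hypothesis Kv : forall n j, K (cell_vec N E v n j) = 0.

Let w := cell_vec N E v.

Let mcell n j : measurable (cell N n j : set (measurableTypeR R)).
Proof. exact: measurable_cell. Qed.

Let V := [set y | forall n j, dotp y (w n j) = 0].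

Let dotp_eq0 (x y : H) : rdot x y = 0 -> rdot x ('i *: y) = 0 -> dotp x y = 0.
Proof.
rewrite /rdot dotpZr; case: (dotp x y) => p q /= -> h.
by apply/eqP; rewrite eq_complex/=; apply/andP; split=> //; apply/eqP; lra.
Qed.

Let rdot_small (x y : H) (C : R) : 0 <= C ->
  (forall e, 0 < e -> exists2 z, rdot x z = 0 & rdot (y - z) (y - z) <= e * C) ->
  rdot x y = 0.
Proof.
move=> C0 h; apply/eqP; rewrite -sqrf_eq0 eq_le sqr_ge0 andbT.
apply/ler_addgt0Pr => e e0; rewrite add0r.
pose D := rdot x x * C + 1.
have D0 : 0 < D by rewrite ltr_wpDl// mulr_ge0 ?rdot_ge0.
have [z xz yz] := h (e / D) (divr_gt0 e0 D0).
have -> : rdot x y = rdot x (y - z) by rewrite (formBr rdot_symmetric) xz subr0.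
apply: le_trans (psd_CauchySchwarz rdot_psd _ _) _.
apply: le_trans (ler_wpM2l (rdot_ge0 x) yz) _.
have -> : rdot x x * (e / D * C) = e * ((rdot x x * C) / D) by ring.
by rewrite ler_piMr ?(ltW e0)// ler_pdivrMr// mul1r lerDl.
Qed.

(* Approximate [T (w n j)] by a combination of the [w] of the [d]-th
   generation subcells. *)
Let T_approx d n j : exists g : H, [/\ forall y, V y -> dotp y g = 0,
    E (cell N n j) g = g
  & rdot (T (w n j) - g) (T (w n j) - g) <=
    ((2 ^+ (n + d))^-1) ^+ 2 * rdot (w n j) (w n j)].
Proof.
elim: d n j => [|d IH] n j.
  exists ((j%:R / 2 ^+ n - N%:R)%:C *: w n j); split.
  - by move=> y Vy; rewrite dotpZr Vy mulr0.
  - by rewrite linearZ/= /w /cell_vec pvm_idem.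
  - rewrite addn0; apply: (spectral_near TE Tsa (mcell n j)).
      exact: pvm_idem.
    by move=> l; exact: cell_range.
have [g1 [V1 E1 h1]] := IH n.+1 j.*2; have [g2 [V2 E2 h2]] := IH n.+1 j.*2.+1.
have disj : cell N n.+1 j.*2 `&` cell N n.+1 j.*2.+1 = set0 :> set R.
  by rewrite cell_disjoint// neq_ltn leqnn.
have sub1 : cell N n.+1 j.*2 `<=` (cell N n j : set R).
  by rewrite (cell_refine N n j); exact: subsetUl.
have sub2 : cell N n.+1 j.*2.+1 `<=` (cell N n j : set R).
  by rewrite (cell_refine N n j); exact: subsetUr.
exists (g1 + g2); split.
- by move=> y Vy; rewrite dotp_conj dotpDl rmorphD/= -!dotp_conj V1// V2// addr0.
- by rewrite raddfD/= -{1}E1 -{1}E2 !pvm_subset// E1 E2.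
have wE : w n j = w n.+1 j.*2 + w n.+1 j.*2.+1 by exact: cell_vec_refine.
set x1 := T (w n.+1 j.*2) - g1; set x2 := T (w n.+1 j.*2.+1) - g2.
rewrite -/x1 in h1; rewrite -/x2 in h2.
have -> : T (w n j) - (g1 + g2) = x1 + x2.
  by rewrite wE (self_adjointD Tsa) opprD addrACA.
have x1E : E (cell N n.+1 j.*2) x1 = x1.
  by rewrite /x1 raddfB/= E1 /w /cell_vec -(spectral_commutes TE Tsa)// pvm_idem.
have x2E : E (cell N n.+1 j.*2.+1) x2 = x2.
  by rewrite /x2 raddfB/= E2 /w /cell_vec -(spectral_commutes TE Tsa)// pvm_idem.
(* The errors on the two halves are orthogonal, as are the halves themselves, so squared norms add
   and the constant does not grow with [d]. *)
have x12 : rdot x1 x2 = 0 by rewrite -x1E -x2E pvm_orth.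
have w12 : rdot (w n.+1 j.*2) (w n.+1 j.*2.+1) = 0 by exact: pvm_orth.
rewrite (form_sqrD rdot_symmetric) x12 mulr0 addr0.
rewrite wE (form_sqrD rdot_symmetric) w12 mulr0 addr0 mulrDr addnS -addSn.
exact: lerD.
Qed.

(** [V] is the orthogonal complement of all cell vectors. It contains the range of [K] because [K]
    kills them, and it is invariant under [A] because [A w = T w] is a limit of combinations of cell
    vectors. Cyclicity leaves only [V = H]. *)
Let V_all y : V y.
Proof.
suff : [set: H] `<=` V by exact.
rewrite -K_cyclic; apply: smallest_sub; last first.
  by move=> _ [x _ <-] n j; rewrite Ksa Kv dotp_conj dot0p rmorph0.
split; first split.
- apply: closed_rdotP => x hx n j.
  have h z : (forall y, V y -> rdot y z = 0) -> rdot x z = 0.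
    move=> hz; rewrite rdotC; apply: (@rdot_small z x 1) => // e e0.
    have [g Vg gx] := hx e e0; exists g; first by rewrite rdotC hz.
    by rewrite mulr1 ltW.
  apply: dotp_eq0; apply: h => z Vz; rewrite /rdot ?dotpZr Vz ?mulr0//.
- by move=> n j; rewrite dot0p.
- by move=> a x z Vx Vz n j; rewrite dotp_linear Vx Vz mulr0 addr0.
- move=> x Vx n j; rewrite Asa -TA; last exact: Kv.
  have h (c : R[i]) : complex.Re c ^+ 2 + complex.Im c ^+ 2 = 1 ->
      rdot x (c *: T (w n j)) = 0.
    move=> c1; apply: (@rdot_small _ _ (rdot (w n j) (w n j))) => [|e e0].
      exact: rdot_ge0.
    (* The error of [T_approx] involves the square of the cell length; a length below both 1 and [e]
       has its square below [e]. *)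
    have m0 : 0 < Num.min 1 e by rewrite lt_min ltr01.
    have [d hd] := small_dyadic m0.
    have [g [Vg _ hg]] := T_approx d n j; exists (c *: g).
      by rewrite /rdot dotpZr Vg// mulr0.
    rewrite -scalerBr rdotZZ c1 mul1r; apply: le_trans hg _.
    apply: ler_wpM2r; first exact: rdot_ge0.
    have := hd (n + d)%N (leq_addl _ _); rewrite lt_min => /andP[d1 d2].
    apply: ltW; apply: le_lt_trans d2; rewrite expr2.
    by apply: ler_piMl; [rewrite invr_ge0 exprn_ge0|exact: ltW].
  apply: dotp_eq0; last by apply: h; rewrite /= expr0n expr1n add0r.
  by rewrite -[T _]scale1r; apply: h; rewrite /= expr0n expr1n addr0.
Qed.

(** Each cell vector is orthogonal to itself, and the cells of level 0 already cover the window that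
    carries [v]. *)
Lemma cyclic_cell_vec_eq0 : v = 0.
Proof.
have w0 n j : w n j = 0.
  apply: rdot_eq0; rewrite {1}/w /cell_vec pvm_rdot// pvm_idem//.
  by rewrite /rdot V_all.
apply: rdot_eq0; apply: EFin_inj; rewrite -{1}vN -scalar_measure_rdot; last first.
  exact: measurable_window.
have mC : measurable (\bigcup_j cell N 0 j : set (measurableTypeR R)).
  by apply: bigcup_measurable => j _; exact: mcell.
apply/eqP; rewrite eq_le measure_ge0 andbT.
have U0 : scalar_measure E v (\bigcup_j cell N 0 j) = 0%E.
  apply: null_bigcup => j; first exact: mcell.
  have := w0 0%N j; rewrite /w /cell_vec => wj.
  by rewrite [LHS](scalar_measure_rdot E v (mcell 0 j)) wj (form0l rdot_symmetric).
rewrite -[leRHS]/0%E -U0; apply: le_measure; rewrite ?inE//; first exact: measurable_window.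
by move=> x /(window_cell 0)[j _ xj]; exists j.
Qed.

End cyclicity.

(** * Hausdorff dimension of countable unions of Lipschitz graphs *)

Section hausdorff_covers.
Context {R : realType} {T : Type} (d : T -> T -> R).
Hypothesis d_ge0 : forall x y, 0 <= d x y.
Implicit Types (S U : set T) (s delta x : R).
Local Open Scope ereal_scope.

Lemma diameter_le U x : (forall p q, U p -> U q -> (d p q <= x)%R) ->
  diameter d U <= x%:E.
Proof.
by move=> h; apply: ge_ereal_sup => _ [[p q] [/= Up Uq] <-]; rewrite lee_fin h.
Qed.

Lemma diameter_power_ge0 s U : 0 <= diameter_power d s U.
Proof. by rewrite /diameter_power; case: ifP => // _; exact: poweR_ge0. Qed.

Lemma diameter_power_le s U x : (0 <= s)%R -> (0 <= x)%R ->
  (forall p q, U p -> U q -> (d p q <= x)%R) ->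
  diameter_power d s U <= (x `^ s)%:E.
Proof.
move=> s0 x0 h; rewrite /diameter_power; case: asboolP => [_|/eqP/set0P[p Up]].
  by rewrite lee_fin powR_ge0.
have := diameter_le h.
have : 0 <= diameter d U.
  apply: (@le_trans _ _ (d p p)%:E); first by rewrite lee_fin.
  by apply: ereal_sup_ubound; exists (p, p).
case: (diameter d U) => [r r0 rx| |//]; last by rewrite leye_eq.
by rewrite poweR_EFin; rewrite !lee_fin in r0 rx *; rewrite ge0_ler_powR.
Qed.

(** Finite covers suffice for bounded Lipschitz graphs, and countably many of them can be listed as
    a single sequence with geometrically decreasing budgets. *)
Definition economical s S := forall eta delta : R, (0 < eta)%R -> (0 < delta)%R ->
  exists (M : nat) (U : nat -> set T), [/\ S `<=` \bigcup_(j in [set j | (j < M)%N]) U j,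
    forall j, diameter d (U j) <= delta%:E
  & \sum_(j < M) diameter_power d s (U j) <= eta%:E].

Lemma hausdorff_measure_economical s (E : set T) (P : nat -> set T) :
  E `<=` \bigcup_m P m -> (forall m, economical s (P m)) ->
  hausdorff_measure d s E = 0.
Proof.
move=> EP eP; apply/eqP; rewrite eq_le; apply/andP; split; last first.
  apply: (@le_trans _ _ (hausdorff_premeasure d s 1%R E)); last first.
    by apply: ereal_sup_ubound; exists 1%R => //=.
  apply: le_ereal_inf_tmp => _ [U _ <-].
  by apply: nneseries_ge0 => k _ _; exact: diameter_power_ge0.
apply: ge_ereal_sup => _ [delta /= delta0 <-].
apply/lee_addgt0Pr => eta eta0; rewrite add0e.
have e0 m : (0 < eta / (2 ^ m.+1)%:R)%R by rewrite divr_gt0// ltr0n expn_gt0.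
have /choice[M hM] m : exists M, exists U : nat -> set T,
    [/\ P m `<=` \bigcup_(j in [set j | (j < M)%N]) U j,
      forall j, diameter d (U j) <= delta%:E
    & \sum_(j < M) diameter_power d s (U j) <= (eta / (2 ^ m.+1)%:R)%:E].
  by have [M [U hU]] := eP m _ _ (e0 m) delta0; exists M, U.
have {hM} /choice[U hU] := hM.
(* Finite covers are padded by empty sets, whose [diameter_power] is 0 by convention, and then
   enumerated along a bijection of the naturals with pairs. *)
pose V (k : nat * nat) := if (k.2 < M k.1)%N then U k.1 k.2 else set0.
have /card_set_bijP[f bf] : ([set: nat] #= [set: nat * nat])%card.
  by apply/card_esym; exact: card_nat2.
apply: (@le_trans _ _ (\sum_(0 <= i <oo) diameter_power d s (V (f i)))).
  apply: ereal_inf_lbound; exists (V \o f) => //; split=> [x Ex|i /=].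
    have [m _ Px] := EP x Ex; have [hc _ _] := hU m.
    have [j /= jM Ux] := hc x Px.
    have [_ _ sf] := bf; have [i _ fi] := sf (m, j) I.
    by exists i => //=; rewrite fi /V/= jM.
  rewrite /V; case: ifP => _; first by have [_ + _] := hU (f i).1; exact.
  by apply: diameter_le => p q [].
rewrite nneseries_esumT; last by move=> i; exact: diameter_power_ge0.
rewrite -(@reindex_esum _ _ _ _ _ _ (fun k => diameter_power d s (V k)) bf).
have -> : [set: nat * nat] = [set: nat] `*`` (fun=> [set: nat]).
  by apply/seteqP; split=> -[].
rewrite -(@esum_esum _ _ _ setT (fun=> setT) (fun i j => diameter_power d s (V (i, j)))); last first.
  by move=> i j _ _; exact: diameter_power_ge0.
rewrite -nneseries_esumT; last by move=> i; apply: esum_ge0 => j _; exact: diameter_power_ge0.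
apply: le_trans (epsilon_trick0 xpredT (ltW eta0)).
apply: lee_nneseries => [i _ _|m _].
  by apply: esum_ge0 => j _; exact: diameter_power_ge0.
have [_ _ hm] := hU m; apply: le_trans hm.
rewrite -nneseries_esumT; last by move=> j; exact: diameter_power_ge0.
rewrite (nneseries_split 0 (M m)); last by move=> j _; exact: diameter_power_ge0.
rewrite add0n [X in _ + X]eseries0 ?adde0; last first.
  move=> j jM _; rewrite /V/= ltnNge jM/= /diameter_power.
  by rewrite asboolT.
rewrite big_mkord; apply: lee_sum => j _.
by rewrite /V/= ltn_ord.
Qed.

Lemma hausdorff_dim_le_countable (E : set T) (P : nat -> set T) :
  E `<=` \bigcup_m P m -> (forall s m, (1 < s)%R -> economical s (P m)) ->
  hausdorff_dim d E <= 1.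
Proof.
move=> EP eP; apply/lee_addgt0Pr => e e0.
apply: ereal_inf_lbound; exists (1 + e)%R => //=; split; first by rewrite addr_ge0// ltW.
by apply: hausdorff_measure_economical EP _ => m; apply: eP; rewrite ltrDl.
Qed.

End hausdorff_covers.

(** * Lipschitz graphs in the plane *)

Section lipschitz_pieces.
Context {R : realType}.
Implicit Types (p q : R * R) (S : set (R * R)).

Lemma euclidean_dist_ge0 p q : 0 <= euclidean_dist p q.
Proof. exact: sqrtr_ge0. Qed.

(* Cut along the coordinate [g] that controls the distance into dyadic cells. *)
Lemma economical_graph S (g : R * R -> R) (s : R) (N : nat) : 1 < s ->
  (forall p q, S p -> S q ->
     `|p.1 - q.1| <= 2 * `|g p - g q| /\ `|p.2 - q.2| <= 2 * `|g p - g q|) ->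
  economical euclidean_dist s (S `&` [set p | window N (g p)]).
Proof.
move=> s1 hS eta delta eta0 delta0.
(* There are [2 N 2^n] cells, each of diameter at most [3 * 2^-n] since [sqrt 8 < 3]. Their [s]-sum
   is at most [6 N (3 * 2^-n)^(s - 1)], and [x0] is the scale at which this drops below [eta]; the
   [+ 1] covers [N = 0]. *)
pose x0 := (eta / (6 * N%:R + 1)) `^ ((s - 1)^-1).
have N0 : 0 <= N%:R :> R by exact: ler0n.
have D0 : 0 < 6 * N%:R + 1 :> R by rewrite ltr_wpDl// mulr_ge0.
have x00 : 0 < x0 by rewrite powR_gt0// divr_gt0.
have m0 : 0 < Num.min (x0 / 3) (delta / 3) by rewrite lt_min !divr_gt0.
have [n /(_ n (leqnn n))] := small_dyadic m0.
rewrite lt_min => /andP[n1 n2].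
have p0 : 0 < 2 ^+ n :> R by rewrite exprn_gt0.
set x := (2 ^+ n)^-1 in n1 n2; have xp : 0 < x by rewrite invr_gt0.
pose U j := S `&` [set p | cell N n j (g p)].
have dU j p q : U j p -> U j q -> euclidean_dist p q <= 3 * x.
  move=> [Sp gp] [Sq gq].
  have /= /andP[a1 a2] := cell_range gp; have /= /andP[b1 b2] := cell_range gq.
  rewrite -/x in a1 a2 b1 b2.
  have gx : `|g p - g q| <= x by rewrite ler_norml; apply/andP; split; lra.
  have [h1 h2] := hS p q Sp Sq.
  have x3 : 0 <= 3 * x by rewrite mulr_ge0// ltW.
  rewrite /euclidean_dist -[leRHS](ger0_norm x3) -sqrtr_sqr ler_wsqrtr//.
  have sq (u : R) : `|u| <= 2 * x -> u ^+ 2 <= (2 * x) ^+ 2.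
    move=> ux; rewrite -(real_normK (num_real u)) ler_pXn2r// nnegrE.
    by rewrite mulr_ge0// ltW.
  have s1' := sq _ (le_trans h1 (ler_wpM2l (ler0n _ 2) gx)).
  have s2' := sq _ (le_trans h2 (ler_wpM2l (ler0n _ 2) gx)).
  rewrite exprMn; rewrite exprMn in s1' s2'.
  have : 0 <= x ^+ 2 by exact: sqr_ge0.
  by lra.
exists (cells (2 * N) n), U; split.
- move=> p [Sp /= wp]; have [j jJ jp] := window_cell n wp.
  by exists j.
- move=> j; apply: (le_trans (diameter_le (dU j))).
  by rewrite lee_fin; lra.
- apply: (@le_trans _ _ (\sum_(j < cells (2 * N) n) ((3 * x) `^ s)%:E)%E).
    apply: lee_sum => j _; apply: diameter_power_le.
    + exact: euclidean_dist_ge0.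
    + lra.
    + by rewrite mulr_ge0// ltW.
    + exact: dU.
  rewrite sumEFin lee_fin sumr_const card_ord.
  rewrite -[leLHS]mulr_natl /cells !natrM natrX.
  have x3 : 0 < 3 * x by exact: mulr_gt0.
  have -> : (3 * x) `^ s = 3 * x * (3 * x) `^ (s - 1).
    rewrite -{2}(powRr1 (ltW x3)) -powRD; last by apply/implyP => _; rewrite gt_eqF.
    by rewrite addrC subrK.
  have -> : 2%:R * N%:R * 2 ^+ n * (3 * x * (3 * x) `^ (s - 1)) =
      6 * N%:R * (3 * x) `^ (s - 1) by rewrite /x; field; rewrite gt_eqF.
  have h : (3 * x) `^ (s - 1) <= eta / (6 * N%:R + 1).
    have -> : eta / (6 * N%:R + 1) = x0 `^ (s - 1).
      rewrite /x0 -powRrM mulVf ?powRr1//; first by rewrite ltW// divr_gt0.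
      by rewrite gt_eqF// subr_gt0.
    apply: ge0_ler_powR; rewrite ?nnegrE; [lra|exact: ltW|exact: ltW|]; lra.
  apply: (@le_trans _ _ (6 * N%:R * (eta / (6 * N%:R + 1)))).
    by apply: ler_wpM2l h; rewrite mulr_ge0.
  rewrite mulrCA ler_piMr ?(ltW eta0)// ler_pdivrMr//; lra.
Qed.

Lemma exists_window (x : R) : exists N, window N x.
Proof.
exists (Num.trunc `|x|).+1; apply/windowP.
have /andP[_ h] := Num.Theory.truncn_itv (normr_ge0 x).
have := ltW h; rewrite ler_norml => /andP[-> _]/=.
by apply: le_lt_trans h; exact: ler_norm.
Qed.

Lemma hausdorff_dim_pieces (I : countType) (E : set (R * R)) (P : I -> set (R * R)) :
  E `<=` \bigcup_i P i ->
  (forall i, (forall p q, P i p -> P i q -> `|p.1 - q.1| <= 2 * `|p.2 - q.2|) \/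
             (forall p q, P i p -> P i q -> `|p.2 - q.2| <= 2 * `|p.1 - q.1|)) ->
  (hausdorff_dim euclidean_dist E <= 1)%E.
Proof.
move=> EP hP.
have /choice[g hg] i : exists g : R * R -> R, forall p q, P i p -> P i q ->
    `|p.1 - q.1| <= 2 * `|g p - g q| /\ `|p.2 - q.2| <= 2 * `|g p - g q|.
  have [h|h] := hP i; [exists snd|exists fst] => p q Pp Pq;
    split; by [exact: h|rewrite mulr2n mulrDl mul1r lerDl].
pose Q m : set (R * R) := if unpickle m is Some (i, N) then
  P i `&` [set p | window N (g i p)] else set0.
apply: (@hausdorff_dim_le_countable _ _ _ E Q).
  move=> p /EP[i _ Pp]; have [N wN] := exists_window (g i p).
  by exists (pickle (i, N)) => //; rewrite /Q pickleK.
move=> s m s1; rewrite /Q; case: unpickle => [[i N]|].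
  by apply: economical_graph => //; exact: hg.
by move=> eta delta eta0 delta0; exists 0%N, (fun=> set0); split=> //;
  [move=> j; apply: diameter_le => p q []|rewrite big_ord0 lee_fin ltW].
Qed.

End lipschitz_pieces.

(** * The exceptional set *)

Lemma separable_sequence (R : realType) (H : hilbertType R) : separable_space H ->
  exists e : nat -> H, forall (x : H) (eps : R), 0 < eps ->
    exists n, rdot (x - e n) (x - e n) <= eps.
Proof.
move=> [D /countable_injP[f injf] denseD].
exists (fun n => xget 0 [set x | D x /\ f x = n]) => x eps eps0.
have se0 : 0 < (Num.sqrt eps)%:C :> R[i] by rewrite ltcR sqrtr_gt0.
have [y [By Dy]] : ball x (Num.sqrt eps)%:C `&` D !=set0.
  apply: denseD; last exact: ball_open.
  by exists x; exact: ballxx.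
exists (f y); case: xgetP => [z _ [Dz fz]|]; last by move=> /(_ y); case.
have -> : z = y by apply: injf => //; rewrite inE.
move: By; rewrite -ball_normE/= normE ltcR ltr_sqrt// => h.
exact: ltW.
Qed.

(** Monotone bounded sequences are within [c / 100] of their suprema from some [n0] on; the last
    bound holds because the supremum of [b] does not exceed that of [a]. Restricting [c] to values
    [1 / (m + 1)] keeps the later classification countable. *)
Lemma dominated_tails (R : realType) (a b : nat -> R) (B : R) :
  {homo a : m n / (m <= n)%N >-> m <= n} -> {homo b : m n / (m <= n)%N >-> m <= n} ->
  (forall n, a n <= B) -> (forall n, b n <= B) ->
  sup (range b) <= sup (range a) -> 0 < sup (range a) ->
  exists m n0, let c := m.+1%:R^-1 in c <= a n0 /\ forall n, (n0 <= n)%N ->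
    [/\ a n <= a n0 + c / 100, b n <= b n0 + c / 100 & b n <= a n0 + c / 100].
Proof.
move=> ah bh aB bB ba a0.
have sa : has_sup (range a) by split; [exists (a 0%N), 0%N|exists B => _ [n _ <-]].
have sb : has_sup (range b) by split; [exists (b 0%N), 0%N|exists B => _ [n _ <-]].
have la n : a n <= sup (range a) by apply: ub_le_sup; [exact: sa.2|exists n].
have lb n : b n <= sup (range b) by apply: ub_le_sup; [exact: sb.2|exists n].
have [m _ /(_ m (leqnn m)) /= hm] := near_infty_natSinv_lt (PosNum a0).
pose c : R := m.+1%:R^-1; rewrite -/c in hm.
have c0 : 0 < c by rewrite invr_gt0.
(* The first entry makes [a] nearly exhausted, the second keeps it above [c]. *)
have g0 : 0 < Num.min (c / 100) (sup (range a) - c).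
  by rewrite lt_min subr_gt0 hm andbT divr_gt0.
have c1 : 0 < c / 100 by exact: divr_gt0.
have [_ [n1 _ <-] h1] := sup_adherent g0 sa.
have [_ [n2 _ <-] h2] := sup_adherent c1 sb.
pose n0 := maxn n1 n2; exists m, n0; rewrite /= -/c.
have hn1 := ah n1 n0 (leq_maxl _ _); have hn2 := bh n2 n0 (leq_maxr _ _).
have [h3 h4] : sup (range a) - c / 100 < a n1 /\ c < a n1.
  have : Num.min (c / 100) (sup (range a) - c) <= c / 100 by rewrite ge_min lexx.
  have : Num.min (c / 100) (sup (range a) - c) <= sup (range a) - c.
    by rewrite ge_min lexx orbT.
  by move: h1 => h1 h5 h6; split; lra.
split; first lra.
by move=> n nn; have := la n; have := lb n; split; lra.
Qed.

Section subordinate_vectors.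
Context {R : realType} {H : hilbertType R}.
Variables (sigma : {finite_measure set (measurableTypeR R) -> \bar R}) (F : pvm H) (u : H).

(** Take [v = F D u / sqrt M]: the scaling absorbs the factor [M], which is nonzero because [D] is
    charged. *)
Lemma subordinate_part (D : set (measurableTypeR R)) (M : nat) : measurable D ->
  scalar_measure F u D <> 0%E ->
  (forall B, measurable B -> B `<=` D ->
     (scalar_measure F u B <= M%:R%:E * sigma B)%E) ->
  exists v, [/\ subordinate sigma F v, v <> 0
    & forall B, measurable B -> D `<=` B -> F B v = v].
Proof.
move=> mD nD dom.
have DE B : measurable B -> rdot (F B (F D u)) (F D u) = rdot (F (B `&` D) u) u.
  move=> mB; rewrite -pvm_setI// rdotC pvm_rdot// pvm_subset//; last first.
  - exact: measurableI.
  - exact: rdotC.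
have M0 : (0 < M)%N.
  rewrite lt0n; apply/negP => /eqP M0; apply: nD; apply/eqP.
  by rewrite eq_le measure_ge0 andbT (le_trans (dom D mD _))// M0 mul0e.
pose a : R := (Num.sqrt M%:R)^-1.
have a2 : a * a * M%:R = 1.
  rewrite /a -invfM -expr2 sqr_sqrtr// mulVf// pnatr_eq0 -lt0n//.
exists (a%:C *: F D u); split.
- move=> B mB; rewrite scalar_measure_rdot// linearZ/= rdotZl.
  rewrite (formZr rdot_symmetric) mulrA DE//.
  have mBD : measurable (B `&` D) by exact: measurableI.
  have h := dom _ mBD (@subIsetr _ _ _); rewrite scalar_measure_rdot// in h.
  have le1 : (sigma (B `&` D) <= sigma B)%E.
    by apply: le_measure; rewrite ?inE//; exact: subIsetl.
  apply: le_trans le1.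
  move: h; rewrite -(fineK (fin_num_measure sigma _ mBD)) -EFinM !lee_fin => h.
  rewrite -[leRHS]mul1r -[X in _ <= X * _]a2 -[leRHS]mulrA.
  by apply: ler_wpM2l => //; rewrite -expr2 sqr_ge0.
- move=> v0; apply: nD; rewrite scalar_measure_sqr//.
  have : a%:C *: F D u = 0 by [].
  move=> /eqP; rewrite scaler_eq0 => /orP[/eqP a0|/eqP ->].
    by move: a2; rewrite (_ : a = 0) ?mul0r => [/eqP|]; [rewrite eq_sym oner_eq0|case: a0].
  by rewrite (form0l rdot_symmetric).
- by move=> B mB DB; rewrite linearZ/= pvm_subset.
Qed.

End subordinate_vectors.

Section profile_approximation.
Context {R : realType} {H : hilbertType R}.
Variables (e : nat -> H) (ka kb : H -> H -> R) (C : R).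
Hypothesis e_dense : forall (x : H) (eps : R), 0 < eps ->
  exists n, rdot (x - e n) (x - e n) <= eps.
Hypotheses (C0 : 0 < C) (kaC : forall x, ka x x <= C * rdot x x)
  (kbC : forall x, kb x x <= C * rdot x x).

(** Each [W j] is rounded with squared error proportional to its own weight, so every term costs at
    most [eps / (J + 1)]; terms of weight 0 vanish since [0^-1 = 0]. A finite list of indices
    records the result. *)
Lemma profile_approx (J : nat) (s : nat -> R) (W : nat -> H) (eps : R) : 0 < eps ->
  (forall j, 0 <= s j) -> exists ds : seq nat,
    let D j := e (nth 0%N ds j) in
    wform ka J s (fun j => W j - D j) (fun j => W j - D j) <= eps /\
    wform kb J s (fun j => W j - D j) (fun j => W j - D j) <= eps.
Proof.
move=> eps0 s0.
pose h := eps / J.+1%:R; have h0 : 0 < h by exact: divr_gt0.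
have /choice[f hf] j : exists n, s j = 0 \/ C * rdot (W j - e n) (W j - e n) <= s j * h.
  have [sj|sj] := eqVneq (s j) 0; first by exists 0%N; left.
  have sp : 0 < s j by rewrite lt_def sj s0.
  have [n hn] := e_dense (W j) (divr_gt0 (mulr_gt0 sp h0) C0).
  by exists n; right; rewrite mulrC -ler_pdivlMr.
exists (mkseq f J) => /=.
have bound k : (forall x, k x x <= C * rdot x x) ->
    wform k J s (fun j => W j - e (nth 0%N (mkseq f J) j))
                (fun j => W j - e (nth 0%N (mkseq f J) j)) <= eps.
  move=> kC; apply: (@le_trans _ _ (\sum_(j < J) h)).
    apply: ler_sum => j _; rewrite nth_mkseq//.
    have [->|sj] := eqVneq (s j) 0; first by rewrite invr0 mulr0 ltW.
    have sp : 0 < s j by rewrite lt_def sj s0.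
    have [/eqP|hj] := hf j; first by rewrite (negPf sj).
    by rewrite ler_pdivrMr// mulrC; apply: le_trans (kC _) hj.
  rewrite sumr_const card_ord -[leLHS]mulr_natl /h mulrCA ler_piMr ?ltW//.
  by rewrite ltr_pdivrMr ?mul1r ?ltr_nat.
by split; exact: bound.
Qed.

End profile_approximation.

(** * Classification of the exceptional parameters *)

Section two_parameter_family.
Context {R : realType} {H : hilbertType R}.
Variables (A K : {linear H -> H}) (EK : pvm H).
Variable sigma : {finite_measure set (measurableTypeR R) -> \bar R}.
Hypotheses (Asa : self_adjoint A) (Ksa : self_adjoint K).
Hypothesis KE : spectral_pvm K EK.
Hypothesis K_cyclic : cyclic_set A (range K).
Variables (CK tau : R).
Hypothesis KC : rbounded K CK.
Hypotheses (trp : trace_bounded (positive_part K EK) tau)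
  (trn : trace_bounded (negative_part K EK) tau).
Variable e : nat -> H.
Hypothesis e_dense : forall (x : H) (eps : R), 0 < eps ->
  exists n, rdot (x - e n) (x - e n) <= eps.
Variable C : nat -> nat -> set (measurableTypeR R).
Hypotheses (mC : forall N i, measurable (C N i))
  (C_window : forall N i, C N i `<=` window N)
  (C_thin : forall N i, thin N (C N i))
  (C_full : sigma (~` \bigcup_N \bigcup_i C N i) = 0%E).

Let Kp := positive_part K EK.
Let Kn := negative_part K EK.
Let kp x y := rdot (Kp x) y.
Let kn x y := rdot (Kn x) y.

Let At (t : R * R) := fun u => A u + t.1%:C *: Kp u + t.2%:C *: Kn u.

Let kp_psd : psd_form kp. Proof. exact: positive_part_psd. Qed.
Let kn_psd : psd_form kn. Proof. exact: negative_part_psd. Qed.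

Let self_adjoint_scaled (S : H -> H) (a : R) :
  self_adjoint S -> self_adjoint (fun u => a%:C *: S u).
Proof.
move=> Ssa u v; rewrite dotpZl dotpZr Ssa; congr (_ * _).
by apply/eqP; rewrite eq_complex/= oppr0 !eqxx.
Qed.

Let self_adjoint_add (S S' : H -> H) :
  self_adjoint S -> self_adjoint S' -> self_adjoint (fun u => S u + S' u).
Proof.
move=> Ssa Ssa' u v; rewrite dotpDl Ssa Ssa' [RHS]dotp_conj dotpDl rmorphD/=.
by rewrite -!dotp_conj.
Qed.

Let At_self_adjoint t : self_adjoint (At t).
Proof.
apply: self_adjoint_add; last first.
  by apply: self_adjoint_scaled; exact: negative_part_self_adjoint.
apply: self_adjoint_add => //.
by apply: self_adjoint_scaled; exact: positive_part_self_adjoint.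
Qed.

Let At_diff t t' x y : rdot (At t x) y - rdot (At t' x) y =
  (t.1 - t'.1) * kp x y + (t.2 - t'.2) * kn x y.
Proof. by rewrite /At !rdotDl !rdotZl /kp /kn; ring. Qed.

(** All scalar spectral measures count here, so off this set each of them, in particular one of
    maximal type, is singular to [sigma]. *)
Definition exceptional : set (R * R) := [set t | exists F u,
  spectral_pvm (At t) F /\ ~ mutually_singular (scalar_measure F u) sigma].

Let carrier t N i F v := [/\ spectral_pvm (At t) F, subordinate sigma F v, v <> 0,
  F (C N i) v = v & F (window N) v = v].

Let exceptional_carrier t : exceptional t -> exists N i F v, carrier t N i F v.
Proof.
move=> [F [u [Ft ns]]].
have [B mB B0 CB0|N [i [M [D [mD DC D0 dom]]]]] :=
    dominated_part (nu := scalar_measure F u) mC C_full.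
  by apply: ns; exists B.
have [v [Fv v0 vB]] := subordinate_part mD D0 dom.
exists N, i, F, v; split=> //; first exact: vB.
apply: vB; first exact: measurable_window.
exact: subset_trans DC (@C_window N i).
Qed.

Let q N := @qform R H (2 * N) (cell_mass N sigma).

Let q_mono N k F v : psd_form k -> subordinate sigma F v ->
  {homo (fun n => q N k n (cell_vec N F v) (cell_vec N F v)) :
     m n / (m <= n)%N >-> m <= n}.
Proof.
move=> kpsd Fv m n mn; apply: qform_refine => //.
- exact: cell_mass_ge0.
- exact: cell_mass_refine.
- exact: cell_vec_adapted.
Qed.

(** If both forms vanished at every level, positivity would give [K_+ w_j = K_- w_j = 0], so [K]
    would kill every cell vector and cyclicity would force [v = 0]. *)
Let carrier_nonvanishing t N i F v : carrier t N i F v ->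
  exists n, 0 < q N kp n (cell_vec N F v) (cell_vec N F v) \/
            0 < q N kn n (cell_vec N F v) (cell_vec N F v).
Proof.
move=> [Ft Fv v0 _ Fw]; apply: contrapT => hn; apply: v0.
have s0 n j : 0 <= cell_mass N sigma n j := cell_mass_ge0 N sigma n j.
have zero (S : H -> H) : psd_form (fun x y => rdot (S x) y) ->
    (forall n, ~ 0 < q N (fun x y => rdot (S x) y) n (cell_vec N F v) (cell_vec N F v)) ->
    forall n j, (j < cells (2 * N) n)%N -> cell_vec N F v n j <> 0 ->
    S (cell_vec N F v n j) = 0.
  move=> Sp h n j jJ w0.
  have term_ge0 (j' : 'I_(cells (2 * N) n)) : true ->
      0 <= rdot (S (cell_vec N F v n j')) (cell_vec N F v n j') / cell_mass N sigma n j'.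
    by move=> _; rewrite divr_ge0// (psd_ge0 Sp).
  have : q N (fun x y => rdot (S x) y) n (cell_vec N F v) (cell_vec N F v) = 0.
    apply/eqP; rewrite eq_le leNgt; apply/andP; split; first exact/negP/h.
    exact: sumr_ge0.
  move=> /eqP; rewrite /q /qform /wform psumr_eq0// => /allP/(_ (Ordinal jJ)).
  rewrite mem_index_enum => /(_ isT); rewrite mulf_eq0 => /orP[/eqP S0|/eqP s1].
    by apply: rdot_inj => z; rewrite (psd_eq0l Sp z S0) (form0l rdot_symmetric).
  case: w0; apply: (cell_vec_adapted N Fv).2.
  by apply/eqP; rewrite -invr_eq0 s1.
apply: (@cyclic_cell_vec_eq0 _ _ A K (At t) F N v) => //.
  (* The spectral projections commute with [K], so both parts vanish on its kernel and [A_t] agrees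
     with [A] there. *)
  move=> u Ku; rewrite /At /Kp /Kn /positive_part /negative_part.
  by rewrite !(spectral_commutes KE Ksa) ?Ku ?raddf0 ?oppr0 ?scaler0 ?addr0//;
    exact: measurable_itv.
move=> n j; have [jJ|jJ] := ltnP j (cells (2 * N) n); last first.
  have -> : cell_vec N F v n j = 0.
    rewrite /cell_vec -Fw -pvm_setI//; [|exact: measurable_cell|exact: measurable_window].
    suff -> : cell N n j `&` window N = set0 :> set R by rewrite pvm_set0.
    apply: contrapT => /eqP/set0P[x [xj /(window_cell n)[j' j'J xj']]].
    by move: jJ; rewrite (cell_inj xj xj') leqNgt j'J.
  exact: linear0.
have [->|/eqP w0] := eqVneq (cell_vec N F v n j) 0; first exact: linear0.
rewrite (spectral_partsE Ksa KE) -/Kp -/Kn.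
rewrite (zero _ kp_psd _ n j jJ w0); last by move=> m h; apply: hn; exists m; left.
rewrite (zero _ kn_psd _ n j jJ w0) ?subr0//.
by move=> m h; apply: hn; exists m; right.
Qed.

Let good N ka kb (c : R) n0 (ds : seq nat) :=
  @well_profiled R H (2 * N) (cell_mass N sigma) ka kb c n0 (fun j => e (nth 0%N ds j)).

Let fst_form (flag : bool) := if flag then kp else kn.
Let snd_form (flag : bool) := if flag then kn else kp.

Let form_psd flag : psd_form (fst_form flag) /\ psd_form (snd_form flag).
Proof. by case: flag. Qed.

(** A countable type holding all discrete data of a carrier: the thin set, which form dominates, the
    threshold, the level and the rounded profile. *)
Definition piece_index := (nat * nat * bool * nat * nat * seq nat)%type.

Let piece (I : piece_index) : set (R * R) :=
  let: (N, i, flag, m, n0, ds) := I in [set t | exists F v, carrier t N i F v /\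
    good N (fst_form flag) (snd_form flag) m.+1%:R^-1 n0 ds (cell_vec N F v)].

Let exceptional_pieces : exceptional `<=` \bigcup_I piece I.
Proof.
move=> t /exceptional_carrier[N [i [F [v hv]]]].
have [Ft Fv v0 _ _] := hv.
pose w := cell_vec N F v.
have kpB n : q N kp n w w <= tau.
  by apply: cell_vec_trace => //; exact: kp_psd.1.
have knB n : q N kn n w w <= tau.
  by apply: cell_vec_trace => //; exact: kn_psd.1.
have [flag [ba a0]] : exists flag,
    sup (range (fun n => q N (snd_form flag) n w w)) <=
    sup (range (fun n => q N (fst_form flag) n w w)) /\
    0 < sup (range (fun n => q N (fst_form flag) n w w)).
  have lub k : (forall n, q N k n w w <= tau) -> forall n,
      q N k n w w <= sup (range (fun n => q N k n w w)).
    move=> kB n; apply: ub_le_sup; last by exists n.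
    by exists tau => _ [m _ <-].
  have [n hn] := carrier_nonvanishing hv.
  have h1 := lub kp kpB n; have h2 := lub kn knB n.
  have [le|/ltW le] := leP (sup (range (fun n => q N kn n w w)))
                           (sup (range (fun n => q N kp n w w))).
    exists true; split=> //=; case: hn => h; first exact: lt_le_trans h1.
    by apply: lt_le_trans (le_trans h2 le).
  exists false; split=> //=; case: hn => h; last exact: lt_le_trans h2.
  by apply: lt_le_trans (le_trans h1 le).
have [fp sp] := form_psd flag.
have fB n : q N (fst_form flag) n w w <= tau by case: flag {ba a0 fp sp}.
have sB n : q N (snd_form flag) n w w <= tau by case: flag {ba a0 fp sp fB}.
have [m [n0 [ca tails]]] := dominated_tails (q_mono N fp Fv) (q_mono N sp Fv) fB sB ba a0.
have CK0 : 0 < CK + 1 by rewrite ltr_wpDl// KC.1.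
have pC x : kp x x <= (CK + 1) * rdot x x.
  by apply: rbounded_form; exact: positive_part_bounded.
have nC x : kn x x <= (CK + 1) * rdot x x.
  by apply: rbounded_form; exact: negative_part_bounded.
have fC x : fst_form flag x x <= (CK + 1) * rdot x x by case: flag {ba a0 fp sp fB sB ca tails}.
have sC x : snd_form flag x x <= (CK + 1) * rdot x x.
  by case: flag {ba a0 fp sp fB sB ca tails fC}.
have c0 : 0 < m.+1%:R^-1 / 400 :> R by rewrite divr_gt0// invr_gt0.
have [ds [hD1 hD2]] := profile_approx e_dense CK0 fC sC (cells (2 * N) n0) (w n0) c0
  (cell_mass_ge0 N sigma n0).
exists (N, i, flag, m, n0, ds) => //; exists F, v; split=> //; split=> //.
exact: cell_vec_adapted.
Qed.

Let piece_cone (I : piece_index) t t' : piece I t -> piece I t' ->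
  let: (_, _, flag, _, _, _) := I in
  if flag then `|t.1 - t'.1| <= 2 * `|t.2 - t'.2|
  else `|t.2 - t'.2| <= 2 * `|t.1 - t'.1|.
Proof.
case: I => [[[[[N i] flag] m] n0] ds] /= [F [v [[Ft Fv _ FC _] gv]]].
move=> [F' [v' [[Ft' Fv' _ _ _] gv']]].
have small (eps : R) : 0 < eps -> exists2 n, (n0 <= n)%N &
    `|(t.1 - t'.1) * q N kp n (cell_vec N F v) (cell_vec N F' v') +
      (t.2 - t'.2) * q N kn n (cell_vec N F v) (cell_vec N F' v')| <= eps.
  (* Half of [eps] offsets the factor 2 in [commutator_bound]. *)
  move=> eps0; have [n nn hn] := @C_thin N i (eps / 2) n0 (divr_gt0 eps0 (ltr0n _ 2)).
  exists n => //; have := @commutator_bound _ _ N sigma _ _ _ _ _ _ _ n Ft (At_self_adjoint t) Ft'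
    (At_self_adjoint t') Fv Fv' (mC N i) FC.
  have -> : \sum_(j < cells (2 * N) n)
     (rdot (At t (cell_vec N F v n j)) (cell_vec N F' v' n j) -
      rdot (At t' (cell_vec N F v n j)) (cell_vec N F' v' n j)) / cell_mass N sigma n j =
     (t.1 - t'.1) * q N kp n (cell_vec N F v) (cell_vec N F' v') +
     (t.2 - t'.2) * q N kn n (cell_vec N F v) (cell_vec N F' v').
    rewrite /q /qform /wform !mulr_sumr -big_split/=; apply: eq_bigr => j _.
    by rewrite At_diff; ring.
  by move=> h; apply: le_trans h _; lra.
have c0 : 0 < m.+1%:R^-1 :> R by rewrite invr_gt0.
case: flag gv gv' => /= gv gv'.
  by apply: (well_profiled_cone (cell_mass_ge0 N sigma) (cell_mass_refine N sigma)
    kp_psd kn_psd c0 gv gv').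
apply: (well_profiled_cone (cell_mass_ge0 N sigma) (cell_mass_refine N sigma)
    kn_psd kp_psd c0 gv gv') => eps eps0.
by have [n nn hn] := small eps eps0; exists n => //; rewrite addrC.
Qed.

Lemma exceptional_dim : (hausdorff_dim euclidean_dist exceptional <= 1)%E.
Proof.
apply: (hausdorff_dim_pieces exceptional_pieces) => I.
have hI := @piece_cone I; case: I hI => [[[[[N i] flag] m] n0] ds] hI.
by case: flag hI => hI; [left|right] => p p' Pp Pp'; exact: hI.
Qed.

End two_parameter_family.

Lemma thin_exhaustion (R : realType)
    (sigma : {finite_measure set (measurableTypeR R) -> \bar R}) :
  mutually_singular sigma lebesgue_measure ->
  exists C : nat -> nat -> set (measurableTypeR R),
    [/\ forall N i, measurable (C N i), forall N i, C N i `<=` window N,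
        forall N i, thin N (C N i) & sigma (~` \bigcup_N \bigcup_i C N i) = 0%E].
Proof.
move=> [B [mB B0 LB]]; have mZ := measurableC mB.
have /choice[C hC] N := thin_cover N sigma mZ LB.
exists C; split=> [N|N|N|]; try by have [] := hC N.
have mC N i : measurable (C N i) by have [] := hC N.
have mCN N : measurable (\bigcup_i C N i) by exact: bigcup_measurable.
have mr N : measurable ((~` B `&` window N) `\` \bigcup_i C N i).
  by apply: measurableD => //; apply: measurableI => //; exact: measurable_window.
have mrest : measurable (\bigcup_N ((~` B `&` window N) `\` \bigcup_i C N i)).
  exact: bigcup_measurable.
have h : sigma (B `|` \bigcup_N ((~` B `&` window N) `\` \bigcup_i C N i)) = 0%E.
  apply/eqP; rewrite eq_le measure_ge0 andbT.
  apply: le_trans (measureU2 _ mB mrest) _.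
  rewrite [X in (X + _)%E]B0 add0e le_eqVlt; apply/orP; left; apply/eqP.
  by apply: null_bigcup => // N; have [] := hC N.
apply/eqP; rewrite eq_le measure_ge0 andbT -h; apply: le_measure; rewrite ?inE.
- by apply: measurableC; exact: bigcup_measurable.
- exact: measurableU.
move=> x nx; have [Bx|nBx] := pselect (B x); [by left|right].
have [N wx] := exists_window x; exists N => //; split=> // xC.
by apply: nx; exists N.
Qed.

Theorem theorem1p5 (R : realType) (H : hilbertType R)
    (A K : {linear H -> H}) (EK : pvm H)
    (sigma : {finite_measure set (measurableTypeR R) -> \bar R}) :
  separable_space H ->
  bounded_operator A -> self_adjoint A ->
  bounded_operator K -> self_adjoint K -> trace_class K ->
  mutually_singular sigma lebesgue_measure ->
  spectral_pvm K EK ->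
  cyclic_set A (range K) ->
  exists E : set (R * R),
    (hausdorff_dim euclidean_dist E <= 1)%E /\
    forall t : R * R, ~ E t ->
    forall mu : set (measurableTypeR R) -> \bar R,
      spectral_measure
        (fun u => A u + t.1%:C *: positive_part K EK u
                      + t.2%:C *: negative_part K EK u) mu ->
      mutually_singular mu sigma.
Proof.
move=> sepH _ Asa Kb Ksa Ktr sing KE Kcyc.
have [CK KC] := bounded_operatorP Kb.
have [tau [trp trn]] := spectral_parts_trace Ksa KE KC Ktr.
have [e e_dense] := separable_sequence sepH.
have [C [mC Cw Ct C0]] := thin_exhaustion sing.
exists (exceptional A K EK sigma); split.
  exact: (exceptional_dim Asa Ksa KE Kcyc KC trp trn e_dense mC Cw Ct C0).
move=> t nE mu [F [u [Ft _ ->]]].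
by apply: contrapT => ns; apply: nE; exists F, u.
Qed.
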